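(* Let $A_1=(1,1,0,0)$ and $A_2=(1,a,b,c)$ be given points in $\mathbf{S}^2\times\mathbf{R}$ or $\mathbf{H}^2\times\mathbf{R}$, and let $\alpha$ ($0<\alpha<\pi$) be a given angle. For a point $P=(1,x,y,z)$ of the geometry put $\mathbf{a}_1=(1,0,0)$, $\mathbf{a}_2=(a,b,c)$, $\mathbf{p}=(x,y,z)$. Let $A_1'=A_1$, $A_2'$ and $P'$ be the projected images of $A_1$, $A_2$ and $P$ onto the unit surface of the geometry (the sphere in $\mathbf{S}^2\times\mathbf{R}$, the hyperboloid in $\mathbf{H}^2\times\mathbf{R}$) along the corresponding fibre lines. Let $d_1$ and $d_2$ be the distances of $P'$ to $A_1'$ and to $A_2'$, and let $\gamma$ be the internal angle at $P'$ in the triangle $A_1'A_2'P'$. Then the $\alpha$-isoptic surface of the segment $\overline{A_1A_2}$ has the equation $$\cos(\alpha)=\frac{d_1d_2\cos(\gamma)+\ln\frac{|\mathbf{a}_1|}{|\mathbf{p}|}\cdot\ln\frac{|\mathbf{a}_2|}{|\mathbf{p}|}}{\sqrt{\left(\ln^2\frac{|\mathbf{a}_1|}{|\mathbf{p}|}+d_1^2\right)\left(\ln^2\frac{|\mathbf{a}_2|}{|\mathbf{p}|}+d_2^2\right)}}.$$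
   Context: Models. A point with homogeneous coordinates $(1,x,y,z)$ is identified with $(x,y,z)\in\mathbb{R}^3$. The space $\mathbf{S}^2\times\mathbf{R}$ is $\mathbb{R}^3\setminus\{0\}$, with $|\mathbf{p}|=\sqrt{x^2+y^2+z^2}$ for $\mathbf{p}=(x,y,z)$. The space $\mathbf{H}^2\times\mathbf{R}$ is the open cone $\{(x,y,z): x>0,\ x^2-y^2-z^2>0\}$, with $|\mathbf{p}|=\sqrt{x^2-y^2-z^2}$. The unit surface is $\{|\mathbf{p}|=1\}$: the unit sphere for $\mathbf{S}^2\times\mathbf{R}$, and the sheet $x>0$ of the hyperboloid $x^2-y^2-z^2=1$ for $\mathbf{H}^2\times\mathbf{R}$. The fibre lines are the open rays $\{e^t\mathbf{q}:t\in\mathbb{R}\}$ with $\mathbf{q}$ on the unit surface; projection to the unit surface along fibre lines is $\mathbf{p}\mapsto\mathbf{p}/|\mathbf{p}|$. Metric. In $\mathbf{S}^2\times\mathbf{R}$, with $x=e^t\cos\theta$, $y=e^t\sin\theta\cos\phi$, $z=e^t\sin\theta\sin\phi$, one has $ds^2=dt^2+d\theta^2+\sin^2\theta\,d\phi^2$. In $\mathbf{H}^2\times\mathbf{R}$, with $x=e^t\cosh r$, $y=e^t\sinh r\cos\phi$, $z=e^t\sinh r\sin\phi$, one has $ds^2=dt^2+dr^2+\sinh^2 r\,d\phi^2$. Translation curves. With $(C,S)=(\cos,\sin)$ for $\mathbf{S}^2\times\mathbf{R}$ and $(\cosh,\sinh)$ for $\mathbf{H}^2\times\mathbf{R}$,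 the translation curves starting at $(1,1,0,0)$, parametrized by arc length $\tau$, are $x(\tau)=e^{\tau\sin v}C(\tau\cos v)$, $y(\tau)=e^{\tau\sin v}S(\tau\cos v)\cos u$, $z(\tau)=e^{\tau\sin v}S(\tau\cos v)\sin u$, with $-\pi<u\le\pi$, $-\frac{\pi}{2}\le v\le\frac{\pi}{2}$. Translation curves from other points are the images of these under isometries; they coincide with the geodesics. Points are joined by translation curves (the shortest one, if there are several), and the distance of two points is the arc length of the translation curve joining them. Isoptic surface. The $\alpha$-isoptic surface of a segment $\overline{A_1A_2}$ is the locus of points $P$ for which the internal angle at $P$ in the triangle formed by $A_1$, $A_2$ and $P$ is $\alpha$. The internal angle at a vertex of a triangle is the angle, in the metric of the geometry, between the tangent vectors at that vertex of the translation curves drawn from it to the other two vertices. *)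

(* Defs.v *)
From Stdlib Require Import Reals Lra.
From Coquelicot Require Import Coquelicot.
Open Scope R_scope.

(* A point (1,x,y,z) in homogeneous coordinates is the triple (x,y,z);
   tangent vectors are triples as well, the models being open in R^3. *)
Notation R3 := (R * R * R)%type.

Inductive geometry := S2R | H2R.

Definition curvature (G : geometry) : R :=
  match G with S2R => 1 | H2R => -1 end.

Definition gC (G : geometry) : R -> R :=
  match G with S2R => cos | H2R => cosh end.

Definition gS (G : geometry) : R -> R :=
  match G with S2R => sin | H2R => sinh end.

Definition scal3 (k : R) (p : R3) : R3 :=
  let '(x, y, z) := p in (k * x, k * y, k * z).

Definition sub3 (p q : R3) : R3 :=
  let '(x, y, z) := p in let '(x', y', z') := q in (x - x', y - y', z - z').

Definition form (G : geometry) (p q : R3) : R :=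
  let '(x, y, z) := p in let '(x', y', z') := q in
  x * x' + curvature G * (y * y' + z * z').

Definition space (G : geometry) (p : R3) : Prop :=
  match G with
  | S2R => p <> (0, 0, 0)
  | H2R => 0 < fst (fst p) /\ 0 < form H2R p p
  end.

Definition norm3 (G : geometry) (p : R3) : R := sqrt (form G p p).

Definition unit_proj (G : geometry) (p : R3) : R3 := scal3 (/ norm3 G p) p.

(* The metric ds^2 = dt^2 + dr^2 + S(r)^2 dphi^2, written without the polar
   coordinates because these degenerate on the axis through (1,0,0).
   With p = e^t q and q on the unit surface, dt(u) = form p u / form p p, and
   u - dt(u) p = e^t dq(u) is the component of u orthogonal to the fibre; the
   form is definite, with the sign of the curvature, on the planes tangent to
   the unit surface.  See metric_polar below. *)
Definition fibre_part (G : geometry) (p u : R3) : R := form G p u / form G p p.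

Definition surface_part (G : geometry) (p u : R3) : R3 :=
  sub3 u (scal3 (fibre_part G p u) p).

Definition metric (G : geometry) (p u w : R3) : R :=
  fibre_part G p u * fibre_part G p w
  + curvature G * form G (surface_part G p u) (surface_part G p w) / form G p p.

Definition polar (G : geometry) (t r phi : R) : R3 :=
  (exp t * gC G r, exp t * (gS G r * cos phi), exp t * (gS G r * sin phi)).

Lemma is_derive_pair {U V : NormedModule R_AbsRing} (f : R -> U) (g : R -> V)
    (s : R) (a : U) (b : V) :
  is_derive f s a -> is_derive g s b ->
  is_derive (fun s => (f s, g s) : prod_NormedModule R_AbsRing U V) s (a, b).
Proof.
  intros Hf Hg.
  apply (filterdiff_comp_2 f g (fun x y => (x, y) : prod_NormedModule R_AbsRing U V)
    (fun y : R => scal y a) (fun y : R => scal y b)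
    (fun x y => (x, y) : prod_NormedModule R_AbsRing U V)); [exact Hf | exact Hg |].
  apply filterdiff_ext_lin with (fun x => x); [| now intros []].
  apply filterdiff_ext with (fun x => x); [now intros [] | apply filterdiff_id].
Qed.

Lemma is_derive_triple (f g h : R -> R) (s a b c : R) :
  is_derive f s a -> is_derive g s b -> is_derive h s c ->
  is_derive (fun s => (f s, g s, h s) : R3) s ((a, b, c) : R3).
Proof.
  intros Hf Hg Hh.
  exact (is_derive_pair (fun s => (f s, g s) : prod_NormedModule _ _ _) h s (a, b) c
    (is_derive_pair f g s a b Hf Hg) Hh).
Qed.

Lemma gC_gS (G : geometry) (r : R) :
  gC G r * gC G r + curvature G * (gS G r * gS G r) = 1.
Proof.
  destruct G; simpl.
  - generalize (sin2_cos2 r); unfold Rsqr; lra.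
  - unfold cosh, sinh.
    assert (H : exp r * exp (- r) = 1) by (rewrite <- exp_plus, Rplus_opp_r; apply exp_0).
    lra.
Qed.

Lemma is_derive_gC (G : geometry) (r : R) :
  is_derive (gC G) r (- curvature G * gS G r).
Proof.
  destruct G; simpl.
  - apply is_derive_Reals. replace (- (1) * sin r) with (- sin r) by ring.
    apply derivable_pt_lim_cos.
  - apply is_derive_Reals. replace (- -1 * sinh r) with (sinh r) by ring.
    apply derivable_pt_lim_cosh.
Qed.

Lemma is_derive_gS (G : geometry) (r : R) : is_derive (gS G) r (gC G r).
Proof.
  destruct G; apply is_derive_Reals;
    [apply derivable_pt_lim_sin | apply derivable_pt_lim_sinh].
Qed.

Lemma metric_polar (G : geometry) (t r phi : R -> R) (s dt dr dphi : R) :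
  is_derive t s dt -> is_derive r s dr -> is_derive phi s dphi ->
  exists w : R3,
    is_derive (fun s => polar G (t s) (r s) (phi s)) s w /\
    metric G (polar G (t s) (r s) (phi s)) w w
      = dt ^ 2 + dr ^ 2 + gS G (r s) ^ 2 * dphi ^ 2.
Proof.
  intros Ht Hr Hp.
  set (e := exp (t s)); set (k := curvature G).
  set (c := gC G (r s)); set (si := gS G (r s)).
  set (cp := cos (phi s)); set (sp := sin (phi s)).
  assert (He : is_derive (fun s => exp (t s)) s (dt * e))
    by (apply (is_derive_comp exp t); [apply is_derive_exp | exact Ht]).
  assert (HC : is_derive (fun s => gC G (r s)) s (dr * (- k * si)))
    by (apply (is_derive_comp (gC G) r); [apply is_derive_gC | exact Hr]).
  assert (HS : is_derive (fun s => gS G (r s)) s (dr * c))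
    by (apply (is_derive_comp (gS G) r); [apply is_derive_gS | exact Hr]).
  assert (Hcp : is_derive (fun s => cos (phi s)) s (dphi * - sp))
    by (apply (is_derive_comp cos phi); [apply is_derive_cos | exact Hp]).
  assert (Hsp : is_derive (fun s => sin (phi s)) s (dphi * cp))
    by (apply (is_derive_comp sin phi); [apply is_derive_sin | exact Hp]).
  exists (dt * e * c + e * (dr * (- k * si)),
     dt * e * (si * cp) + e * (dr * c * cp + si * (dphi * - sp)),
     dt * e * (si * sp) + e * (dr * c * sp + si * (dphi * cp))).
  assert (Hm : forall (f g : R -> R) a b, is_derive f s a -> is_derive g s b ->
      is_derive (fun s => f s * g s) s (a * g s + f s * b))
    by (intros; apply (is_derive_mult f g); auto; apply Rmult_comm).
  split.
  - unfold polar; apply is_derive_triple.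
    + exact (Hm _ _ _ _ He HC).
    + exact (Hm _ _ _ _ He (Hm _ _ _ _ HS Hcp)).
    + exact (Hm _ _ _ _ He (Hm _ _ _ _ HS Hsp)).
  - assert (e0 : e <> 0) by (apply Rgt_not_eq, exp_pos).
    assert (Hcs : c * c + k * (si * si) = 1) by apply gC_gS.
    assert (Hp2 : cp * cp + sp * sp = 1)
      by (generalize (sin2_cos2 (phi s)); unfold Rsqr, cp, sp; lra).
    assert (Hk : k * k = 1) by (unfold k; destruct G; simpl; ring).
    unfold metric, surface_part, fibre_part, polar.
    fold e c si cp sp.
    set (w := (dt * e * c + e * (dr * (- k * si)), _, _)).
    assert (Hpp : form G (e * c, e * (si * cp), e * (si * sp))
                    (e * c, e * (si * cp), e * (si * sp)) = e * e).
    { unfold form; fold k.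
      replace (_ + _) with (e * e * (c * c + k * (si * si) * (cp * cp + sp * sp))) by ring.
      rewrite Hp2, Rmult_1_r, Hcs; ring. }
    assert (Hpw : form G (e * c, e * (si * cp), e * (si * sp)) w = e * e * dt).
    { unfold form, w; fold k.
      replace (_ + _) with (e * e * (dt * (c * c + k * (si * si) * (cp * cp + sp * sp))
        + dr * k * si * c * (cp * cp + sp * sp - 1))) by ring.
      rewrite Hp2, Rmult_1_r, Hcs; ring. }
    rewrite Hpw, Hpp.
    replace (e * e * dt / (e * e)) with dt by (field; exact e0).
    unfold w, scal3, sub3, form; fold k.
    match goal with |- _ + _ * ?X / _ = _ =>
      replace X with (e * e * k * (dr * dr * (k * (si * si) + c * c * (cp * cp + sp * sp))
        + si * si * (dphi * dphi) * (cp * cp + sp * sp))) by ring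
    end.
    rewrite Hp2, !Rmult_1_r, (Rplus_comm (k * _)), Hcs.
    replace (k * (e * e * k * (dr * dr * 1 + si * si * (dphi * dphi))) / (e * e))
      with (k * k * (dr * dr + si * si * (dphi * dphi))) by (field; exact e0).
    rewrite Hk; ring.
Qed.

Definition preserves_metric (G : geometry) (f : R3 -> R3) : Prop :=
  forall p, space G p ->
    space G (f p) /\
    exists df : R3 -> R3,
      filterdiff f (locally p) df /\
      forall u w, metric G (f p) (df u) (df w) = metric G p u w.

Definition isometry (G : geometry) (f : R3 -> R3) : Prop :=
  exists g : R3 -> R3,
    preserves_metric G f /\ preserves_metric G g /\
    (forall p, space G p -> g (f p) = p) /\
    (forall p, space G p -> f (g p) = p).

Definition origin : R3 := (1, 0, 0).

Definition base_curve (G : geometry) (u v tau : R) : R3 :=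
  (exp (tau * sin v) * gC G (tau * cos v),
   exp (tau * sin v) * gS G (tau * cos v) * cos u,
   exp (tau * sin v) * gS G (tau * cos v) * sin u).

Definition translation_curve (G : geometry) (P : R3) (c : R -> R3) : Prop :=
  exists (f : R3 -> R3) (u v : R),
    isometry G f /\ f origin = P /\
    - PI < u <= PI /\ - (PI / 2) <= v <= PI / 2 /\
    forall tau, c tau = f (base_curve G u v tau).

(* Translation curves are parametrized by arc length, so L is the length of
   the arc from P to Q. *)
Definition joins (G : geometry) (P Q : R3) (c : R -> R3) (L : R) : Prop :=
  translation_curve G P c /\ 0 <= L /\ c L = Q.

Definition shortest (G : geometry) (P Q : R3) (c : R -> R3) (L : R) : Prop :=
  joins G P Q c L /\ forall c' L', joins G P Q c' L' -> L <= L'.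

Definition is_distance (G : geometry) (P Q : R3) (d : R) : Prop :=
  exists c, shortest G P Q c d.

Definition angle (G : geometry) (p u w : R3) : R :=
  acos (metric G p u w / (sqrt (metric G p u u) * sqrt (metric G p w w))).

(* A relation, since the shortest curve need not be unique: in S2R there is
   one in every horizontal direction when V and A project to antipodal points
   of the sphere.  For V = A the curve has length 0 and any direction. *)
Definition internal_angle (G : geometry) (V A B : R3) (theta : R) : Prop :=
  exists (c1 c2 : R -> R3) (L1 L2 : R) (w1 w2 : R3),
    shortest G V A c1 L1 /\ shortest G V B c2 L2 /\
    is_derive c1 0 w1 /\ is_derive c2 0 w2 /\
    theta = angle G V w1 w2.

Definition isoptic (G : geometry) (alpha : R) (A1 A2 P : R3) : Prop :=
  space G P /\ P <> A1 /\ P <> A2 /\ internal_angle G P A1 A2 alpha.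

(* Main.v *)
Require Import Defs.
From Stdlib Require Import Reals Lra.
From Coquelicot Require Import Coquelicot.
Open Scope R_scope.

(** Writing a point as [exp T] times a point [q] of the unit surface turns the
    space into the metric product of the line and the surface.  In a product, a
    unit-speed geodesic moves along the fibre with constant speed [sg] and along
    a geodesic of the surface with constant speed [ka], where
    [sg ^ 2 + ka ^ 2 = 1]; this is the curve [geodesic] below.  Let it reach
    [A_i] after length [L_i].  Then [L_i * sg_i] is the height difference
    [ln (|a_i| / |p|)], [L_i * ka_i] is the length [d_i] of the projected arc,
    and [L_i ^ 2] is the sum of their squares.  The height difference does not
    depend on the curve, so shortest curves project to shortest arcs and shortest
    arcs lift to shortest curves ([project_shortest], [lift_shortest]).  The
    initial unit vectors at [P] have inner product
    [sg_1 * sg_2 + ka_1 * ka_2 * cos gamma], and multiplying numerator and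
    denominator by [L_1 * L_2] gives the formula.  If [P] lies on the fibre of
    some [A_i] then [d_i = 0] and [gamma] is arbitrary, but it only enters through
    [d_1 * d_2 * cos gamma].

    The substance is that the translation curves, defined as images of the base
    curves under arbitrary isometries, are exactly these geodesics.

    - Every [geodesic] is a translation curve, because a reflection of the
      quadratic form exchanges the origin with any given point of the unit surface,
      and reflections and positive scalings are isometries
      ([geodesic_is_translation_curve]).

    - Conversely, an isometry is only known to be differentiable, so the geodesic
      equation cannot be transported directly.  Lengths can.  A differentiable
      unit-speed path satisfies [dt ^ 2 + r ^ 2 <= length ^ 2], where [dt] is the
      height difference and [r] the separation on the surface of its endpoints
      ([path_length_bound]); this is a calibration argument that uses only the mean
      value theorem.  Applied to an isometry and to its inverse, it shows that the
      image of a geodesic attains equality on short intervals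
      ([isometry_locally_minimizing]).  Equality forces [c s] to be the midpoint of
      [c (s - h)] and [c (s + h)] for small [h], that is,
      [t (s + h) + t (s - h) = 2 * t s] for the height and
      [q (s + h) + q (s - h) = 2 * C (ka * h) * q s] for the projection.  The
      differentiable solutions of these functional equations are affine and
      trigonometric, respectively ([cosine_equation]), which makes the image a
      [geodesic] ([locally_minimizing_geodesic]). *)

(** * Circular and hyperbolic trigonometry *)

Lemma curvature_sq (G : geometry) : curvature G * curvature G = 1.
Proof. destruct G; simpl; ring. Qed.

Lemma gC_0 (G : geometry) : gC G 0 = 1.
Proof. destruct G; [apply cos_0 | apply cosh_0]. Qed.

Lemma gS_0 (G : geometry) : gS G 0 = 0.
Proof. destruct G; [apply sin_0 | apply sinh_0]. Qed.

Lemma gC_plus (G : geometry) (a b : R) :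
  gC G (a + b) = gC G a * gC G b - curvature G * gS G a * gS G b.
Proof.
  destruct G; simpl.
  - rewrite cos_plus; ring.
  - unfold cosh, sinh; rewrite Ropp_plus_distr, !exp_plus; field.
Qed.

Lemma gC_opp (G : geometry) (a : R) : gC G (- a) = gC G a.
Proof.
  destruct G; simpl; [apply cos_neg |].
  unfold cosh; rewrite Ropp_involutive; field.
Qed.

Lemma gS_opp (G : geometry) (a : R) : gS G (- a) = - gS G a.
Proof.
  destruct G; simpl; [apply sin_neg |].
  unfold sinh; rewrite Ropp_involutive; field.
Qed.

Lemma gC_minus (G : geometry) (a b : R) :
  gC G (a - b) = gC G a * gC G b + curvature G * gS G a * gS G b.
Proof. unfold Rminus; rewrite gC_plus, gC_opp, gS_opp; ring. Qed.

(** Half-angle form of the chord: it lets the calibrating function be normalized by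
    [gS G (r / 2)]. *)
Lemma gC_half (G : geometry) (r : R) :
  gC G r = 1 - 2 * curvature G * gS G (r / 2) ^ 2.
Proof.
  replace r with (r / 2 + r / 2) at 1 by field.
  rewrite gC_plus; generalize (gC_gS G (r / 2)); lra.
Qed.

(** The lengths on which [gC G] is injective; on the sphere these are the lengths of
    shortest arcs. *)
Definition arc_range (G : geometry) (r : R) : Prop :=
  match G with S2R => 0 <= r <= PI | H2R => 0 <= r end.

Lemma arc_range_nonneg (G : geometry) (r : R) : arc_range G r -> 0 <= r.
Proof. destruct G; simpl; lra. Qed.

Lemma arc_range_small (G : geometry) (r : R) : 0 <= r <= PI -> arc_range G r.
Proof. destruct G; simpl; lra. Qed.

Lemma exp_lt_opp (a b : R) : a < b -> exp (- b) < exp (- a).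
Proof. intros H; apply exp_increasing; lra. Qed.

Lemma sinh_increasing (a b : R) : a < b -> sinh a < sinh b.
Proof.
  intros H; unfold sinh.
  generalize (exp_increasing _ _ H) (exp_lt_opp _ _ H); lra.
Qed.

Lemma gS_half_lt (G : geometry) (m r : R) :
  arc_range G r -> 0 <= m < r / 2 -> gS G m < gS G (r / 2).
Proof.
  destruct G; simpl; intros Hr Hm.
  - apply sin_increasing_1; lra.
  - apply sinh_increasing; lra.
Qed.

Lemma gS_half_nonneg (G : geometry) (m r : R) :
  arc_range G r -> 0 <= m < r / 2 -> 0 <= gS G m.
Proof.
  destruct G; simpl; intros Hr Hm.
  - apply sin_ge_0; lra.
  - destruct (Rle_lt_or_eq_dec 0 m) as [H | <-]; [lra | | rewrite sinh_0; lra].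
    generalize (sinh_increasing _ _ H); rewrite sinh_0; lra.
Qed.

Lemma cosh_increasing (m r : R) : 0 <= m < r -> cosh m < cosh r.
Proof.
  intros Hm; unfold cosh.
  assert (H1 : exp m < exp r) by (apply exp_increasing; lra).
  assert (H2 : exp (- r) * exp (- m) < 1)
    by (rewrite <- exp_plus, <- exp_0; apply exp_increasing; lra).
  assert (H3 : exp r * exp (- r) = 1) by (rewrite <- exp_plus, Rplus_opp_r; apply exp_0).
  assert (H4 : exp m * exp (- m) = 1) by (rewrite <- exp_plus, Rplus_opp_r; apply exp_0).
  assert (exp r - exp m + (exp (- r) - exp (- m))
    = (exp r - exp m) * (1 - exp (- r) * exp (- m))).
  { replace ((exp r - exp m) * _)
      with (exp r - exp m - exp r * exp (- r) * exp (- m) + exp m * exp (- m) * exp (- r))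
      by ring.
    rewrite H3, H4; ring. }
  assert (0 < (exp r - exp m) * (1 - exp (- r) * exp (- m)))
    by (apply Rmult_lt_0_compat; lra).
  lra.
Qed.

(** [gC G] decreases on the sphere and increases on the hyperboloid, so the factor
    [curvature G] makes the two cases one.  On the sphere [m] may exceed [PI], where
    the conclusion is trivial: this is what the triangle inequality needs. *)
Lemma gC_order (G : geometry) (r m : R) :
  arc_range G r -> 0 <= m -> curvature G * gC G m <= curvature G * gC G r -> r <= m.
Proof.
  destruct G; simpl; intros Hr Hm H.
  - destruct (Rle_dec m PI); [apply cos_decr_0; lra | lra].
  - destruct (Rle_dec r m); [assumption |].
    generalize (cosh_increasing m r); lra.
Qed.

Lemma gC_inj (G : geometry) (r m : R) :
  arc_range G r -> arc_range G m -> gC G r = gC G m -> r = m.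
Proof.
  intros Hr Hm H.
  apply Rle_antisym; apply (gC_order G); eauto using arc_range_nonneg; rewrite H; lra.
Qed.

Lemma gC_onto (G : geometry) (x : R) :
  match G with S2R => -1 <= x <= 1 | H2R => 1 <= x end ->
  exists r, arc_range G r /\ gC G r = x.
Proof.
  destruct G; simpl; intros Hx.
  - exists (acos x); split; [apply acos_bound | apply cos_acos, Hx].
  - exists (arcsinh (sqrt (x * x - 1))); split.
    + rewrite <- arcsinh_0; apply arcsinh_le, sqrt_pos.
    + set (r := arcsinh _).
      assert (Hs : sinh r * sinh r = x * x - 1)
        by (unfold r; rewrite sinh_arcsinh; apply sqrt_sqrt; nra).
      generalize (gC_gS H2R r); simpl; intros Hc.
      assert (0 < cosh r)
        by (unfold cosh; generalize (exp_pos r) (exp_pos (- r)); lra).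
      nra.
Qed.

Lemma gS_nonneg (G : geometry) (r : R) : arc_range G r -> 0 <= gS G r.
Proof.
  destruct G; simpl; intros Hr.
  - apply sin_ge_0; lra.
  - destruct (Rle_lt_or_eq_dec 0 r) as [H | <-]; [lra | | rewrite sinh_0; lra].
    generalize (sinh_increasing _ _ H); rewrite sinh_0; lra.
Qed.

Definition gArcS (G : geometry) : R -> R :=
  match G with S2R => asin | H2R => arcsinh end.

Lemma gArcS_gS (G : geometry) (m r : R) :
  arc_range G r -> - (r / 2) <= m <= r / 2 -> gArcS G (gS G m) = m.
Proof.
  destruct G; simpl; intros Hr Hm; [apply asin_sin; lra | apply arcsinh_sinh].
Qed.

Lemma is_derive_gArcS (G : geometry) (y : R) :
  0 < 1 - curvature G * y ^ 2 ->
  is_derive (gArcS G) y (/ sqrt (1 - curvature G * y ^ 2)).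
Proof.
  destruct G; simpl; intros Hy.
  - assert (H : -1 < y < 1) by nra.
    apply is_derive_Reals.
    replace (/ _) with (derive_pt asin y (derivable_pt_asin y H)).
    + apply derive_pt_eq_1 with (derivable_pt_asin y H); reflexivity.
    + rewrite derive_pt_asin; unfold Rdiv, Rsqr; rewrite Rmult_1_l; do 2 f_equal; ring.
  - apply is_derive_Reals.
    replace (1 - _) with (y ^ 2 + 1) by (simpl; ring).
    apply derivable_pt_lim_arcsinh.
Qed.

(** * The quadratic form and the unit surface *)

Definition comb3 (x : R) (p : R3) (y : R) (q : R3) : R3 :=
  let '(p1, p2, p3) := p in let '(q1, q2, q3) := q in
  (x * p1 + y * q1, x * p2 + y * q2, x * p3 + y * q3).

Ltac triple_eq :=
  apply (f_equal2 (@pair (R * R) R)); [apply (f_equal2 (@pair R R)) |].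

Ltac r3_eq := repeat (match goal with p : R3 |- _ => destruct p as [[? ?] ?] end);
  unfold comb3, scal3, sub3, form; try match goal with |- (_, _, _) = _ => triple_eq end; ring.

Lemma form_sym G p q : form G p q = form G q p.
Proof. r3_eq. Qed.

Lemma form_comb_l G x p y q w :
  form G (comb3 x p y q) w = x * form G p w + y * form G q w.
Proof. r3_eq. Qed.

Lemma form_comb_r G x p y q w :
  form G w (comb3 x p y q) = x * form G w p + y * form G w q.
Proof. r3_eq. Qed.

Lemma sub3_comb3 p q : sub3 p q = comb3 1 p (-1) q.
Proof. r3_eq. Qed.

Lemma form_scal_l G k p q : form G (scal3 k p) q = k * form G p q.
Proof. r3_eq. Qed.

Lemma form_scal_r G k p q : form G p (scal3 k q) = k * form G p q.
Proof. r3_eq. Qed.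

Ltac form_expand :=
  rewrite ?sub3_comb3;
  repeat first [rewrite form_comb_l | rewrite form_comb_r
               | rewrite form_scal_l | rewrite form_scal_r].

Lemma form_nondegenerate G p q : (forall n, form G p n = form G q n) -> p = q.
Proof.
  destruct p as [[p1 p2] p3], q as [[q1 q2] q3]; intros H.
  generalize (H (1, 0, 0)) (H (0, 1, 0)) (H (0, 0, 1)).
  destruct G; simpl; intros; triple_eq; lra.
Qed.

Definition on_surface (G : geometry) (q : R3) : Prop := space G q /\ form G q q = 1.

(** The form has the sign of the curvature on tangent planes of the unit surface,
    whence the normalization. *)
Definition unit_tangent (G : geometry) (q w : R3) : Prop :=
  form G q w = 0 /\ form G w w = curvature G.

Lemma space_form_pos G p : space G p -> 0 < form G p p.
Proof.
  destruct G; simpl; [| tauto].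
  destruct p as [[x y] z]; intros H; simpl.
  destruct (Req_dec x 0), (Req_dec y 0), (Req_dec z 0); try nra.
  subst; now destruct H.
Qed.

(** In the hyperbolic case two timelike vectors lie in the same nappe of the cone as
    soon as their product is positive, by the Cauchy-Schwarz inequality for the two
    spatial components. *)
Lemma space_of_timelike G p q :
  space G p -> 0 < form G q q -> (G = H2R -> 0 < form G p q) -> space G q.
Proof.
  destruct p as [[p1 p2] p3], q as [[q1 q2] q3].
  destruct G; simpl; intros Hp Hq Hpq.
  - intros E; injection E; intros -> -> ->; lra.
  - specialize (Hpq eq_refl); split; [| exact Hq].
    destruct Hp as [Hp1 Hp2].
    destruct (Rlt_dec 0 q1) as [| Hn]; [assumption | exfalso].
    assert (Hcs : (p2 * q2 + p3 * q3) ^ 2 <= (p2 ^ 2 + p3 ^ 2) * (q2 ^ 2 + q3 ^ 2))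
      by (generalize (pow2_ge_0 (p2 * q3 - p3 * q2)); lra).
    assert (Hle : (p2 ^ 2 + p3 ^ 2) * (q2 ^ 2 + q3 ^ 2) <= p1 ^ 2 * q1 ^ 2)
      by (apply Rmult_le_compat; generalize (pow2_ge_0 p2) (pow2_ge_0 p3)
            (pow2_ge_0 q2) (pow2_ge_0 q3); lra).
    assert (0 <= p1 * - q1) by (apply Rmult_le_pos; lra).
    assert (p1 * - q1 < - (p2 * q2 + p3 * q3)) by lra.
    nra.
Qed.

(** Up to the sign [curvature G], the form is an inner product on the plane tangent to
    the unit surface at [q]. *)
Lemma tangent_form G q v :
  on_surface G q -> form G q v = 0 ->
  0 <= curvature G * form G v v /\ (form G v v = 0 -> v = (0, 0, 0)).
Proof.
  destruct q as [[x y] z], v as [[a b] c].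
  unfold on_surface; destruct G; simpl; intros [Hs Hq] Hv.
  - split; [nra |].
    intros H; assert (a = 0) by nra; assert (b = 0) by nra; assert (c = 0) by nra.
    now subst.
  - destruct Hs as [Hx0 _].
    assert (Hx : 0 < x * x) by (apply Rmult_lt_0_compat; lra).
    (* Orthogonality to q expresses x * a by the spatial components, and the
       Lagrange identity evaluates the difference. *)
    assert (E : x * x * (b * b + c * c - a * a)
                = b * b + c * c + (y * c - z * b) * (y * c - z * b)).
    { replace (x * x * (b * b + c * c - a * a))
        with (x * x * (b * b + c * c) - (x * a) * (x * a)) by ring.
      replace (x * a) with (y * b + z * c) by lra.
      replace (x * x) with (1 + y * y + z * z) by lra. ring. }
    assert (0 <= (y * c - z * b) * (y * c - z * b)) by apply Rle_0_sqr.
    split.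
    + assert (0 <= x * x * (b * b + c * c - a * a)) by nra. nra.
    + intros Hvv.
      replace (b * b + c * c - a * a) with 0 in E by lra.
      assert (b = 0) by nra; assert (c = 0) by nra; subst.
      assert (a = 0) by (apply Rsqr_0_uniq; unfold Rsqr; lra).
      now subst.
Qed.

(** Definiteness applied to [form v v * u - form u v * v]. *)
Lemma tangent_cauchy_schwarz G q u v :
  on_surface G q -> form G q u = 0 -> form G q v = 0 ->
  form G u v ^ 2 <= form G u u * form G v v.
Proof.
  intros Hq Hu Hv.
  destruct (tangent_form G q v Hq Hv) as [Hpos Hz].
  assert (Hw : form G q (comb3 (form G v v) u (- form G u v) v) = 0)
    by (rewrite form_comb_r, Hu, Hv; ring).
  destruct (tangent_form G q _ Hq Hw) as [Hw' _].
  rewrite !form_comb_l, !form_comb_r, (form_sym G v u) in Hw'.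
  assert (Hp : 0 <= (curvature G * form G v v)
      * (form G u u * form G v v - form G u v ^ 2)) by lra.
  destruct (Req_dec (form G v v) 0) as [E | E].
  - rewrite (Hz E). rewrite (Hz E) in E. rewrite E.
    replace (form G u (0,0,0)) with 0; [lra |].
    destruct u as [[? ?] ?]; simpl; ring.
  - assert (curvature G * form G v v <> 0)
      by (destruct G; simpl in *; lra).
    assert (0 < curvature G * form G v v) by lra.
    nra.
Qed.

Lemma surface_form_range G p q :
  on_surface G p -> on_surface G q ->
  match G with S2R => -1 <= form G p q <= 1 | H2R => 1 <= form G p q end.
Proof.
  destruct p as [[p1 p2] p3], q as [[q1 q2] q3].
  unfold on_surface; destruct G; simpl; intros [Hp Hp1] [Hq Hq1].
  - split.
    + generalize (pow2_ge_0 (p1 + q1)) (pow2_ge_0 (p2 + q2)) (pow2_ge_0 (p3 + q3)); lra.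
    + generalize (pow2_ge_0 (p1 - q1)) (pow2_ge_0 (p2 - q2)) (pow2_ge_0 (p3 - q3)); lra.
  - destruct Hp as [Hp0 _], Hq as [Hq0 _].
    assert (0 < p1 * q1) by (apply Rmult_lt_0_compat; lra).
    assert ((1 + (p2 * q2 + p3 * q3)) ^ 2 <= (p1 * q1) ^ 2).
    { replace ((p1 * q1) ^ 2) with ((p1 * p1) * (q1 * q1)) by ring.
      replace (p1 * p1) with (1 + p2 * p2 + p3 * p3) by lra.
      replace (q1 * q1) with (1 + q2 * q2 + q3 * q3) by lra.
      generalize (pow2_ge_0 (p2 - q2)) (pow2_ge_0 (p3 - q3)) (pow2_ge_0 (p2 * q3 - p3 * q2)).
      lra. }
    nra.
Qed.

(** The geodesic distance of two points of the unit surface, as a relation so that no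
    inverse of [gC] is needed. *)
Definition separation (G : geometry) (p q : R3) (r : R) : Prop :=
  arc_range G r /\ gC G r = form G p q.

Lemma separation_exists G p q :
  on_surface G p -> on_surface G q -> exists r, separation G p q r.
Proof. intros Hp Hq; apply gC_onto, surface_form_range; assumption. Qed.

(** Splitting [p] and [q] into components along and orthogonal to [m], the product
    [form p q] differs from [gC r1 * gC r2] by the product of two tangent vectors of
    lengths [gS r1] and [gS r2]; Cauchy-Schwarz compares it with [gC (r1 + r2)]. *)
Lemma separation_triangle G p m q r1 r2 r :
  on_surface G p -> on_surface G m -> on_surface G q ->
  separation G p m r1 -> separation G m q r2 -> separation G p q r -> r <= r1 + r2.
Proof.
  intros Hp Hm Hq [R1 E1] [R2 E2] [R3' E].
  pose proof (arc_range_nonneg _ _ R1). pose proof (arc_range_nonneg _ _ R2).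
  apply (gC_order G); [assumption | lra |].
  rewrite gC_plus, E, E1, E2.
  destruct Hp as [_ Hp], Hm as [Hsm Hm], Hq as [_ Hq].
  set (u := comb3 1 p (- gC G r1) m).
  set (v := comb3 1 q (- gC G r2) m).
  assert (Hu : form G m u = 0)
    by (unfold u; rewrite form_comb_r, Hm, (form_sym G m p), <- E1; ring).
  assert (Hv : form G m v = 0)
    by (unfold v; rewrite form_comb_r, Hm, <- E2; ring).
  pose proof (tangent_cauchy_schwarz G m u v (conj Hsm Hm) Hu Hv) as Hcs.
  assert (Huu : form G u u = curvature G * gS G r1 ^ 2).
  { unfold u; rewrite !form_comb_l, !form_comb_r, (form_sym G m p), Hp, Hm, <- E1.
    generalize (gC_gS G r1); lra. }
  assert (Hvv : form G v v = curvature G * gS G r2 ^ 2).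
  { unfold v; rewrite !form_comb_l, !form_comb_r, (form_sym G q m), Hq, Hm, <- E2.
    generalize (gC_gS G r2); lra. }
  assert (Huv : form G u v = form G p q - form G p m * form G m q).
  { unfold u, v; rewrite !form_comb_l, !form_comb_r, Hm, E1, E2; ring. }
  rewrite Huu, Hvv, Huv in Hcs.
  pose proof (gS_nonneg G r1 R1). pose proof (gS_nonneg G r2 R2).
  assert (0 <= gS G r1 * gS G r2) by (apply Rmult_le_pos; assumption).
  set (d := form G p q - form G p m * form G m q) in Hcs.
  replace (form G p q) with (d + form G p m * form G m q) by (unfold d; ring).
  generalize (form G p m * form G m q) d Hcs.
  set (s := gS G r1 * gS G r2) in *.
  replace (curvature G * gS G r1 ^ 2 * (curvature G * gS G r2 ^ 2))
    with (curvature G * curvature G * s ^ 2) by (unfold s; ring).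
  rewrite curvature_sq; intros x y Hy.
  assert (- s <= y <= s) by (split; nra).
  replace (curvature G * gS G r1 * gS G r2) with (curvature G * s) by (unfold s; ring).
  destruct G; simpl; lra.
Qed.

(** * Cylindrical coordinates *)

Definition point (T : R) (q : R3) : R3 := scal3 (exp T) q.

Definition height (G : geometry) (p : R3) : R := ln (norm3 G p).

Lemma norm3_pos G p : space G p -> 0 < norm3 G p.
Proof. intros Hp; apply sqrt_lt_R0, space_form_pos, Hp. Qed.

Lemma norm3_sq G p : space G p -> norm3 G p * norm3 G p = form G p p.
Proof. intros Hp; apply sqrt_sqrt, Rlt_le, space_form_pos, Hp. Qed.

Lemma space_scal3 G k p : 0 < k -> space G p -> space G (scal3 k p).
Proof.
  intros Hk Hp; pose proof (space_form_pos G p Hp) as Hpp.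
  apply (space_of_timelike G p); [assumption | |].
  - rewrite form_scal_l, form_scal_r; repeat apply Rmult_lt_0_compat; assumption.
  - intros _; rewrite form_scal_r; apply Rmult_lt_0_compat; assumption.
Qed.

Lemma unit_proj_on_surface G p : space G p -> on_surface G (unit_proj G p).
Proof.
  intros Hp; pose proof (norm3_pos G p Hp) as Hn; split.
  - apply space_scal3; [apply Rinv_0_lt_compat |]; assumption.
  - unfold unit_proj; rewrite form_scal_l, form_scal_r, <- (norm3_sq G p Hp); field; lra.
Qed.

Lemma point_height_unit_proj G p :
  space G p -> point (height G p) (unit_proj G p) = p.
Proof.
  intros Hp; pose proof (norm3_pos G p Hp) as Hn.
  unfold point, height, unit_proj; rewrite exp_ln by assumption.
  destruct p as [[x y] z]; unfold scal3; triple_eq; field; lra.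
Qed.

Lemma space_point G T q : on_surface G q -> space G (point T q).
Proof. intros [Hq _]; apply space_scal3; [apply exp_pos | exact Hq]. Qed.

Lemma norm3_point G T q : on_surface G q -> norm3 G (point T q) = exp T.
Proof.
  intros [_ Hq]; unfold norm3, point; rewrite form_scal_l, form_scal_r, Hq, Rmult_1_r.
  apply sqrt_square, Rlt_le, exp_pos.
Qed.

Lemma height_point G T q : on_surface G q -> height G (point T q) = T.
Proof. intros Hq; unfold height; rewrite norm3_point by assumption; apply ln_exp. Qed.

Lemma unit_proj_point G T q : on_surface G q -> unit_proj G (point T q) = q.
Proof.
  intros Hq; unfold unit_proj; rewrite norm3_point by assumption.
  pose proof (exp_pos T).
  destruct q as [[x y] z]; unfold point, scal3; triple_eq; field; lra.
Qed.

Lemma point_inj G T q T' q' :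
  on_surface G q -> on_surface G q' -> point T q = point T' q' -> T = T' /\ q = q'.
Proof.
  intros Hq Hq' E; split.
  - rewrite <- (height_point G T q Hq), E; now apply height_point.
  - rewrite <- (unit_proj_point G T q Hq), E; now apply unit_proj_point.
Qed.

Lemma metric_scal3 G m p u w :
  m <> 0 -> space G p ->
  metric G (scal3 m p) (scal3 m u) (scal3 m w) = metric G p u w.
Proof.
  intros Hm Hp; apply space_form_pos in Hp.
  unfold metric, surface_part, fibre_part.
  form_expand.
  field; split; [lra | exact Hm].
Qed.

(** The product structure: in the frame of a fibre direction and the tangent plane of
    the unit surface the metric is Euclidean, whatever the height [T]. *)
Lemma metric_point G T q s1 e1 s2 e2 :
  on_surface G q -> form G q e1 = 0 -> form G q e2 = 0 ->
  metric G (point T q) (scal3 (exp T) (comb3 s1 q 1 e1)) (scal3 (exp T) (comb3 s2 q 1 e2))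
  = s1 * s2 + curvature G * form G e1 e2.
Proof.
  intros [Hs Hq] H1 H2; unfold point.
  rewrite metric_scal3; [| apply Rgt_not_eq, exp_pos | exact Hs].
  unfold metric, surface_part, fibre_part.
  form_expand; rewrite (form_sym G e1 q), Hq, H1, H2.
  field.
Qed.

(** * Explicit geodesics *)

(** The unit-speed geodesic of the unit surface from [q] in the direction [w]. *)
Definition circle (G : geometry) (q w : R3) (r : R) : R3 := comb3 (gC G r) q (gS G r) w.

Definition circle_tangent (G : geometry) (q w : R3) (r : R) : R3 :=
  comb3 (- curvature G * gS G r) q (gC G r) w.

Definition geodesic (G : geometry) (T : R) (q : R3) (sg ka : R) (w : R3) (tau : R) : R3 :=
  point (T + tau * sg) (circle G q w (tau * ka)).

Definition direction (sg ka : R) : Prop := sg ^ 2 + ka ^ 2 = 1 /\ 0 <= ka.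

Lemma form_circle G q w r s :
  on_surface G q -> unit_tangent G q w ->
  form G (circle G q w r) (circle G q w s) = gC G (s - r).
Proof.
  intros [_ Hq] [Hqw Hw]; unfold circle.
  rewrite !form_comb_l, !form_comb_r, (form_sym G w q), Hq, Hqw, Hw, gC_minus; ring.
Qed.

Lemma gC_H2R_pos r : 0 < gC H2R r.
Proof. simpl; unfold cosh; generalize (exp_pos r) (exp_pos (- r)); lra. Qed.

Lemma circle_0 G q w : circle G q w 0 = q.
Proof.
  unfold circle; rewrite gC_0, gS_0; r3_eq.
Qed.

Lemma circle_on_surface G q w r :
  on_surface G q -> unit_tangent G q w -> on_surface G (circle G q w r).
Proof.
  intros Hq Hw.
  assert (E : form G (circle G q w r) (circle G q w r) = 1)
    by (rewrite form_circle, Rminus_diag, gC_0; auto).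
  split; [| exact E].
  apply (space_of_timelike G q); [apply Hq | lra |].
  intros ->. rewrite <- (circle_0 H2R q w) at 1.
  rewrite form_circle by assumption; apply gC_H2R_pos.
Qed.

Lemma circle_tangent_ortho G q w r :
  on_surface G q -> unit_tangent G q w ->
  unit_tangent G (circle G q w r) (circle_tangent G q w r).
Proof.
  intros [_ Hq] [Hqw Hw]; unfold unit_tangent, circle, circle_tangent.
  rewrite !form_comb_l, !form_comb_r, (form_sym G w q), Hq, Hqw, Hw.
  pose proof (curvature_sq G) as Hk; pose proof (gC_gS G r) as Hc.
  split; [ring |].
  replace (- curvature G * gS G r *
    (- curvature G * gS G r * 1 + gC G r * 0) +
    gC G r * (- curvature G * gS G r * 0 + gC G r * curvature G))
    with (curvature G * (gC G r * gC G r + curvature G * (gS G r * gS G r))) by ring.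
  rewrite Hc; ring.
Qed.

Lemma geodesic_0 G T q sg ka w : geodesic G T q sg ka w 0 = point T q.
Proof. unfold geodesic; now rewrite !Rmult_0_l, circle_0, Rplus_0_r. Qed.

Lemma is_derive_Rmult (f g : R -> R) (s a b : R) :
  is_derive f s a -> is_derive g s b ->
  is_derive (fun s => f s * g s) s (a * g s + f s * b).
Proof. intros Hf Hg; apply (is_derive_mult f g); auto; apply Rmult_comm. Qed.

Lemma is_derive_Rplus (f g : R -> R) (s a b : R) :
  is_derive f s a -> is_derive g s b -> is_derive (fun s => f s + g s) s (a + b).
Proof. intros Hf Hg; exact (is_derive_plus f g s a b Hf Hg). Qed.

Lemma is_derive_Rscal (f : R -> R) (k s a : R) :
  is_derive f s a -> is_derive (fun s => k * f s) s (k * a).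
Proof. intros Hf; exact (is_derive_scal f s k a Hf). Qed.

Lemma is_derive_Rcomp (f g : R -> R) (s a b : R) :
  is_derive f (g s) a -> is_derive g s b -> is_derive (fun s => f (g s)) s (b * a).
Proof. intros Hf Hg; exact (is_derive_comp f g s a b Hf Hg). Qed.

Lemma is_derive_geodesic G T q sg ka w tau :
  is_derive (geodesic G T q sg ka w) tau
    (scal3 (exp (T + tau * sg))
       (comb3 sg (circle G q w (tau * ka)) 1
          (scal3 ka (circle_tangent G q w (tau * ka))))).
Proof.
  assert (H : forall x y, is_derive
     (fun s => exp (T + s * sg) * (gC G (s * ka) * x + gS G (s * ka) * y)) tau
     (exp (T + tau * sg) * (sg * (gC G (tau * ka) * x + gS G (tau * ka) * y)
        + 1 * (ka * (- curvature G * gS G (tau * ka) * x + gC G (tau * ka) * y))))).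
  { intros x y.
    assert (He : is_derive (fun s => exp (T + s * sg)) tau (sg * exp (T + tau * sg)))
      by (auto_derive; [exact I | ring]).
    assert (Hl : is_derive (fun s => s * ka) tau ka) by (auto_derive; [exact I | ring]).
    assert (HC : is_derive (fun s => gC G (s * ka)) tau (ka * (- curvature G * gS G (tau * ka))))
      by exact (is_derive_Rcomp _ _ _ _ _ (is_derive_gC G _) Hl).
    assert (HS : is_derive (fun s => gS G (s * ka)) tau (ka * gC G (tau * ka)))
      by exact (is_derive_Rcomp _ _ _ _ _ (is_derive_gS G _) Hl).
    assert (Hx : is_derive (fun _ : R => x) tau 0) by apply @is_derive_const.
    assert (Hy : is_derive (fun _ : R => y) tau 0) by apply @is_derive_const.
    evar_last.
    { apply is_derive_Rmult; [exact He |].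
      apply is_derive_Rplus; apply is_derive_Rmult; eassumption. }
    simpl; ring. }
  destruct q as [[q1 q2] q3], w as [[w1 w2] w3].
  exact (is_derive_triple _ _ _ _ _ _ _ (H q1 w1) (H q2 w2) (H q3 w3)).
Qed.

(** The derivative need not be continuous: images of smooth curves under isometries
    are only known to be differentiable. *)
Definition unit_speed_path (G : geometry) (c : R -> R3) : Prop :=
  forall s, space G (c s) /\ exists w, is_derive c s w /\ metric G (c s) w w = 1.

Lemma geodesic_unit_speed G T q sg ka w :
  on_surface G q -> unit_tangent G q w -> direction sg ka ->
  unit_speed_path G (geodesic G T q sg ka w).
Proof.
  intros Hq Hw [Hd _] s.
  pose proof (circle_on_surface G q w (s * ka) Hq Hw) as Hc.
  destruct (circle_tangent_ortho G q w (s * ka) Hq Hw) as [Ho Hn].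
  split; [now apply space_point |].
  eexists; split; [apply is_derive_geodesic |].
  unfold geodesic; rewrite metric_point.
  - rewrite form_scal_l, form_scal_r, Hn.
    transitivity (sg * sg + curvature G * curvature G * (ka * ka)); [ring |].
    rewrite curvature_sq; lra.
  - exact Hc.
  - rewrite form_scal_r, Ho; ring.
  - rewrite form_scal_r, Ho; ring.
Qed.

(** * A length bound for differentiable paths *)

Lemma is_derive_components (c : R -> R3) s (w : R3) :
  is_derive c s w ->
  is_derive (fun s => fst (fst (c s))) s (fst (fst w)) /\
  is_derive (fun s => snd (fst (c s))) s (snd (fst w)) /\
  is_derive (fun s => snd (c s)) s (snd w).
Proof.
  intros H.
  assert (Hf : forall (l : R3 -> R), is_linear l -> is_derive (fun s => l (c s)) s (l w)).
  { intros l Hl.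
    apply filterdiff_ext_lin with (fun y : R => l (scal y w)).
    - apply (filterdiff_comp' c l); [exact H | apply filterdiff_linear, Hl].
    - intros y; apply (linear_scal l Hl). }
  split; [| split]; [apply (Hf (fun p => fst (fst p))) | apply (Hf (fun p => snd (fst p))) |
    apply (Hf (fun p => snd p))].
  - apply (is_linear_comp (fun p : R3 => fst p) (fun p => fst p)); apply is_linear_fst.
  - apply (is_linear_comp (fun p : R3 => fst p) (fun p => snd p));
      [apply is_linear_fst | apply is_linear_snd].
  - apply is_linear_snd.
Qed.

Lemma is_derive_form G (c d : R -> R3) s (w v : R3) :
  is_derive c s w -> is_derive d s v ->
  is_derive (fun s => form G (c s) (d s)) s (form G w (d s) + form G (c s) v).
Proof.
  intros Hc Hd.
  destruct (is_derive_components c s w Hc) as [H1 [H2 H3]].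
  destruct (is_derive_components d s v Hd) as [K1 [K2 K3]].
  apply is_derive_ext with (fun s => fst (fst (c s)) * fst (fst (d s))
    + curvature G * (snd (fst (c s)) * snd (fst (d s)) + snd (c s) * snd (d s))).
  - intros t; destruct (c t) as [[? ?] ?], (d t) as [[? ?] ?]; reflexivity.
  - evar_last.
    + apply is_derive_Rplus; [apply is_derive_Rmult; eassumption |].
      apply is_derive_Rscal, is_derive_Rplus; apply is_derive_Rmult; eassumption.
    + destruct w as [[? ?] ?], v as [[? ?] ?], (c s) as [[? ?] ?], (d s) as [[? ?] ?].
      simpl; ring.
Qed.

Lemma is_derive_form_const G (c : R -> R3) s (w n : R3) :
  is_derive c s w -> is_derive (fun s => form G (c s) n) s (form G w n).
Proof.
  intros Hc; evar_last.
  - apply (is_derive_form G c (fun _ => n) s w zero); [exact Hc | apply @is_derive_const].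
  - replace (form G (c s) zero) with 0; [ring |].
    destruct (c s) as [[? ?] ?]; simpl; unfold zero; simpl; ring.
Qed.

Lemma is_derive_norm3 G (c : R -> R3) s (w : R3) :
  space G (c s) -> is_derive c s w ->
  is_derive (fun s => norm3 G (c s)) s (norm3 G (c s) * fibre_part G (c s) w).
Proof.
  intros Hs Hc; pose proof (space_form_pos _ _ Hs) as Hp.
  pose proof (norm3_pos _ _ Hs) as Hn; pose proof (norm3_sq _ _ Hs) as Hq.
  evar_last.
  - apply (is_derive_sqrt (fun s => form G (c s) (c s)));
      [apply is_derive_form; exact Hc | exact Hp].
  - fold (norm3 G (c s)). unfold fibre_part; rewrite (form_sym G w), <- Hq; field; lra.
Qed.

Lemma is_derive_height G (c : R -> R3) s (w : R3) :
  space G (c s) -> is_derive c s w ->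
  is_derive (fun s => height G (c s)) s (fibre_part G (c s) w).
Proof.
  intros Hs Hc; pose proof (norm3_pos _ _ Hs) as Hn.
  evar_last.
  - apply (is_derive_Rcomp ln (fun s => norm3 G (c s)));
      [apply is_derive_ln, Hn | apply is_derive_norm3; eassumption].
  - simpl; field; lra.
Qed.

Lemma is_derive_unit_proj_form G (c : R -> R3) s (w n : R3) :
  space G (c s) -> is_derive c s w ->
  is_derive (fun s => form G (unit_proj G (c s)) n) s
    (form G (scal3 (/ norm3 G (c s)) (surface_part G (c s) w)) n).
Proof.
  intros Hs Hc; pose proof (norm3_pos _ _ Hs) as Hn.
  apply is_derive_ext with (fun s => form G (c s) n / norm3 G (c s)).
  - intros t; unfold unit_proj; rewrite form_scal_l; apply Rmult_comm.
  - evar_last.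
    + apply is_derive_div; [apply is_derive_form_const, Hc
        | apply is_derive_norm3; eassumption | lra].
    + unfold surface_part; rewrite form_scal_l, sub3_comb3, form_comb_l, form_scal_l.
      field; lra.
Qed.

(** The vector [e] is the velocity of the projection to the unit surface, so this is
    the Pythagorean theorem for the speeds in the two factors. *)
Lemma metric_unit_proj G p w :
  space G p ->
  let e := scal3 (/ norm3 G p) (surface_part G p w) in
  form G (unit_proj G p) e = 0 /\
  metric G p w w = fibre_part G p w ^ 2 + curvature G * form G e e.
Proof.
  intros Hp e; pose proof (norm3_pos _ _ Hp) as Hn; pose proof (norm3_sq _ _ Hp) as Hq.
  unfold e; split.
  - unfold unit_proj, surface_part, fibre_part.
    rewrite form_scal_l, form_scal_r, sub3_comb3, form_comb_r, form_scal_r, <- Hq; field; lra.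
  - unfold metric; rewrite form_scal_l, form_scal_r, <- Hq; field; lra.
Qed.

Lemma calibration_bound x y f e g :
  x ^ 2 + y ^ 2 <= 1 -> f ^ 2 + e = 1 -> 0 <= e -> g ^ 2 <= e -> x * f + y * g <= 1.
Proof.
  intros Hxy Hfe He Hg.
  assert ((x * f + y * g) ^ 2 <= 1).
  { assert ((x * f + y * g) ^ 2 <= (x ^ 2 + y ^ 2) * (f ^ 2 + g ^ 2))
      by (generalize (pow2_ge_0 (x * g - y * f)); lra).
    assert ((x ^ 2 + y ^ 2) * (f ^ 2 + g ^ 2) <= 1 * 1); [| lra].
    apply Rmult_le_compat; nra. }
  nra.
Qed.

(** The function [x * height + y * gArcS (k * form q n)] is 1-Lipschitz along unit-speed
    paths.  Indeed [n] has a tangential component at [q] of squared length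
    [k * form n n - k * form q n ^ 2], which is at most the square
    [1 - k * form q n ^ 2] of the denominator in the derivative of [gArcS].  The strict
    inequality [k * form n n < 1] keeps the path away from the points of the sphere
    where [asin] is not differentiable. *)
Lemma calibration G (c : R -> R3) (x y s0 s1 : R) (n : R3) :
  unit_speed_path G c -> s0 <= s1 -> x ^ 2 + y ^ 2 <= 1 ->
  curvature G * form G n n < 1 ->
  x * (height G (c s1) - height G (c s0))
  + y * (gArcS G (curvature G * form G (unit_proj G (c s1)) n)
         - gArcS G (curvature G * form G (unit_proj G (c s0)) n)) <= s1 - s0.
Proof.
  intros Hc Hs Hxy Hn.
  set (h := fun s => x * height G (c s)
    + y * gArcS G (curvature G * form G (unit_proj G (c s)) n)).
  assert (Hh : forall s, exists l, is_derive h s l /\ l <= 1).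
  { intros s; destruct (Hc s) as [Hsp [w [Hw Hm]]].
    destruct (metric_unit_proj G (c s) w Hsp) as [Ho Hm'].
    pose proof (unit_proj_on_surface G (c s) Hsp) as Hq.
    set (q := unit_proj G (c s)) in *.
    set (e := scal3 (/ norm3 G (c s)) (surface_part G (c s) w)) in *.
    set (k := curvature G) in *.
    assert (Hk : k * k = 1) by apply curvature_sq.
    set (nt := comb3 1 n (- form G q n) q).
    assert (Hqq : form G q q = 1) by apply Hq.
    assert (Hnt : form G q nt = 0) by (unfold nt; rewrite form_comb_r, Hqq; ring).
    assert (Hntn : form G nt nt = form G n n - form G q n ^ 2)
      by (unfold nt; rewrite !form_comb_l, !form_comb_r, Hqq, (form_sym G n q); ring).
    assert (Hent : form G e nt = form G e n)
      by (unfold nt; rewrite form_comb_r, (form_sym G e q), Ho; ring).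
    destruct (tangent_form G q nt Hq Hnt) as [Hpos _].
    destruct (tangent_form G q e Hq Ho) as [Hepos _].
    pose proof (tangent_cauchy_schwarz G q e nt Hq Ho Hnt) as Hcs.
    fold k in Hpos, Hepos. rewrite Hent in Hcs. rewrite Hntn in *.
    assert (Hky : k * (k * form G q n) ^ 2 = k * form G q n ^ 2)
      by (replace (k * (k * form G q n) ^ 2) with (k * k * (k * form G q n ^ 2)) by ring;
          rewrite Hk; ring).
    assert (Hg : 0 < 1 - k * (k * form G q n) ^ 2) by (rewrite Hky; lra).
    eexists; split.
    - apply is_derive_Rplus; apply is_derive_Rscal.
      + apply is_derive_height; eassumption.
      + apply (is_derive_Rcomp (gArcS G)).
        * apply is_derive_gArcS; exact Hg.
        * apply is_derive_Rscal, is_derive_unit_proj_form; eassumption.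
    - fold q e k.
      apply calibration_bound with (e := k * form G e e); [exact Hxy | lra | exact Hepos |].
      set (b := 1 - k * (k * form G q n) ^ 2) in *.
      assert (Hb : sqrt b * sqrt b = b) by (apply sqrt_sqrt; lra).
      assert (0 < sqrt b) by now apply sqrt_lt_R0.
      replace ((k * form G e n * / sqrt b) ^ 2)
        with (form G e n ^ 2 / b)
        by (rewrite <- Hb at 1; replace (form G e n ^ 2) with (k * k * form G e n ^ 2)
              by (rewrite Hk; ring); field; lra).
      apply (proj2 (Rle_div_l _ _ _ Hg)).
      apply Rle_trans with (1 := Hcs).
      unfold b; rewrite Hky.
      replace (form G e e * (form G n n - form G q n ^ 2))
        with ((k * form G e e) * (k * (form G n n - form G q n ^ 2)))
        by (transitivity (k * k * (form G e e * (form G n n - form G q n ^ 2)));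
            [ring | rewrite Hk; ring]).
      apply Rmult_le_compat_l; [exact Hepos | lra]. }
  destruct (MVT_gen h s0 s1 (Derive h)) as [xi [_ E]].
  - intros s _; destruct (Hh s) as [l [Hl _]]; apply Derive_correct; now exists l.
  - intros s _; destruct (Hh s) as [l [Hl _]].
    apply continuity_pt_filterlim, (ex_derive_continuous h); now exists l.
  - destruct (Hh xi) as [l [Hl Hl1]]; rewrite (is_derive_unique _ _ _ Hl) in E.
    unfold h in E.
    assert (l * (s1 - s0) <= 1 * (s1 - s0)) by (apply Rmult_le_compat_r; lra).
    lra.
Qed.

(** For [n] proportional to [q - p], the calibrating function grows from [- m] to [m]
    between [p] and [q], and [m] can be chosen as any number below [r / 2] by scaling
    [n].  Letting [m] tend to [r / 2] gives the full separation [r]. *)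
Lemma path_bound G (c : R -> R3) (x y s0 s1 r : R) :
  unit_speed_path G c -> s0 <= s1 -> x ^ 2 + y ^ 2 <= 1 -> 0 <= y ->
  separation G (unit_proj G (c s0)) (unit_proj G (c s1)) r ->
  x * (height G (c s1) - height G (c s0)) + y * r <= s1 - s0.
Proof.
  intros Hc Hs Hxy Hy [Hr Er].
  set (p := unit_proj G (c s0)) in *; set (q := unit_proj G (c s1)) in *.
  pose proof (arc_range_nonneg _ _ Hr) as Hr0.
  destruct (unit_proj_on_surface G (c s0) (proj1 (Hc s0))) as [_ Hp].
  destruct (unit_proj_on_surface G (c s1) (proj1 (Hc s1))) as [_ Hq].
  fold p in Hp; fold q in Hq.
  set (dt := height G (c s1) - height G (c s0)).
  set (k := curvature G); assert (Hk : k * k = 1) by apply curvature_sq.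
  assert (Hm : forall m, 0 <= m < r / 2 -> x * dt + y * (2 * m) <= s1 - s0).
  { intros m Hmr.
    pose proof (gS_half_lt G m r Hr Hmr) as Hlt.
    pose proof (gS_half_nonneg G m r Hr Hmr) as Hnn.
    pose proof (gC_half G r) as Hh. rewrite Er in Hh. fold k in Hh.
    set (b := gS G (r / 2)) in *.
    set (z := gS G m / (2 * b ^ 2)).
    set (n := comb3 z q (- z) p).
    (* By the half-angle formula, k * (1 - form p q) is 2 * b ^ 2, so that z makes
       the values of k * form . n at q and p equal to gS m and - gS m. *)
    assert (Hqn : k * form G q n = gS G m).
    { unfold n; rewrite form_comb_r, (form_sym G q p), Hq, Hh.
      transitivity (k * k * (2 * z * b ^ 2)); [ring |].
      rewrite Hk; unfold z; field; lra. }
    assert (Hpn : k * form G p n = gS G (- m)).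
    { unfold n; rewrite form_comb_r, Hp, Hh, gS_opp.
      transitivity (- (k * k * (2 * z * b ^ 2))); [ring |].
      rewrite Hk; unfold z; field; lra. }
    assert (Hnn' : k * form G n n < 1).
    { unfold n; rewrite form_comb_l; fold n.
      replace (k * (z * form G q n + - z * form G p n))
        with (z * (k * form G q n) - z * (k * form G p n)) by ring.
      rewrite Hqn, Hpn, gS_opp.
      replace (z * gS G m - z * - gS G m) with ((gS G m / b) ^ 2)
        by (unfold z; field; lra).
      assert (gS G m / b < 1) by (apply (Rlt_div_l (gS G m) 1 b); lra).
      assert (0 <= gS G m / b) by (apply Rdiv_le_0_compat; lra).
      nra. }
    pose proof (calibration G c x y s0 s1 n Hc Hs Hxy Hnn') as H.
    fold p q k in H. rewrite Hqn, Hpn in H.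
    rewrite !(gArcS_gS G _ r) in H by (auto; lra).
    fold dt in H; lra. }
  destruct (Req_dec r 0) as [-> | Hr'].
  - replace (y * 0) with (0 * 0 : R) by ring.
    assert (H : curvature G * form G (0, 0, 0) (0, 0, 0) < 1) by (destruct G; simpl; lra).
    pose proof (calibration G c x 0 s0 s1 (0,0,0) Hc Hs) as H'.
    fold dt in H'. assert (x ^ 2 + 0 ^ 2 <= 1) by nra.
    specialize (H' ltac:(assumption) H). lra.
  - destruct (Rle_dec (x * dt + y * r) (s1 - s0)) as [| Hn]; [assumption | exfalso].
    (* If the bound failed by d, it would already fail for m within d / 4 of r / 2,
       since y <= 1. *)
    set (d := x * dt + y * r - (s1 - s0)).
    assert (Hd : 0 < d) by (unfold d; lra).
    assert (Hy1 : y <= 1) by nra.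
    set (m := Rmax 0 (r / 2 - d / 4)).
    assert (Hm0 : 0 <= m < r / 2) by (unfold m, Rmax; destruct Rle_dec; lra).
    assert (Hm1 : r / 2 - d / 4 <= m) by apply Rmax_r.
    specialize (Hm m Hm0).
    assert (y * (r - 2 * m) <= 1 * (d / 2)) by (apply Rmult_le_compat; lra).
    unfold d in *; lra.
Qed.

(** The slopes [x] and [y] of [path_bound] are chosen as the direction cosines of the
    pair [(dt, r)]. *)
Lemma path_length_bound G (c : R -> R3) (s0 s1 r : R) :
  unit_speed_path G c -> s0 <= s1 ->
  separation G (unit_proj G (c s0)) (unit_proj G (c s1)) r ->
  (height G (c s1) - height G (c s0)) ^ 2 + r ^ 2 <= (s1 - s0) ^ 2.
Proof.
  intros Hc Hs Hr.
  pose proof (arc_range_nonneg _ _ (proj1 Hr)) as Hr0.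
  set (dt := height G (c s1) - height G (c s0)).
  set (D := sqrt (dt ^ 2 + r ^ 2)).
  assert (HD : D * D = dt ^ 2 + r ^ 2)
    by (apply sqrt_sqrt; generalize (pow2_ge_0 dt) (pow2_ge_0 r); lra).
  assert (HD0 : 0 <= D) by apply sqrt_pos.
  destruct (Req_dec D 0) as [E | E].
  - rewrite E in HD. generalize (pow2_ge_0 (s1 - s0)); lra.
  - assert (H : dt / D * dt + r / D * r <= s1 - s0).
    { apply (path_bound G c); try assumption.
      - replace ((dt / D) ^ 2 + (r / D) ^ 2) with ((dt ^ 2 + r ^ 2) / (D * D)) by (field; lra).
        rewrite <- HD; apply Req_le; field; lra.
      - apply Rdiv_le_0_compat; lra. }
    replace (dt / D * dt + r / D * r) with D in H
      by (replace (dt / D * dt + r / D * r) with ((dt ^ 2 + r ^ 2) / D) by (field; lra);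
          rewrite <- HD; field; lra).
    rewrite <- HD. nra.
Qed.

(** * Isometric images of geodesics *)

(** Rotating the components [(y, z)] of [q] by a right angle gives a vector that is
    orthogonal to [q] in both geometries; it degenerates on the axis [y = z = 0], where
    any vector with [x = 0] is orthogonal. *)
Lemma unit_tangent_exists G q : exists w, unit_tangent G q w.
Proof.
  destruct q as [[x y] z].
  assert (Hn : 0 <= y * y + z * z) by nra.
  destruct (Req_dec (y * y + z * z) 0) as [E | E].
  - exists (0, 1, 0); assert (y = 0) by nra; subst y.
    destruct G; split; simpl; ring.
  - set (n := sqrt (y * y + z * z)).
    assert (Hs : n * n = y * y + z * z) by (apply sqrt_sqrt; lra).
    assert (Hp : 0 < n) by (apply sqrt_lt_R0; lra).
    exists (0, - z / n, y / n); split; unfold form; [field; lra |].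
    replace (0 * 0 + _) with (curvature G * ((y * y + z * z) / (n * n))) by (field; lra).
    rewrite <- Hs; field; lra.
Qed.

Lemma null_tangent G q v :
  on_surface G q -> form G q v = 0 -> form G v v = 0 -> v = (0, 0, 0).
Proof. intros Hq Hv; apply (tangent_form G q v Hq Hv). Qed.

(** The direction is the component of [q'] orthogonal to [q].  It vanishes when the
    points coincide or are antipodal, and then every direction works. *)
Lemma circle_through G q q' r :
  on_surface G q -> on_surface G q' -> separation G q q' r ->
  exists w, unit_tangent G q w /\ circle G q w r = q'.
Proof.
  intros Hq [_ Hq'] [Hr Er]; pose proof (proj2 Hq) as Hqq.
  pose proof (gC_gS G r) as Hcs.
  set (v := comb3 1 q' (- gC G r) q).
  assert (Hqv : form G q v = 0)
    by (unfold v; form_expand; rewrite Hqq, <- Er; ring).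
  assert (Hvv : form G v v = curvature G * (gS G r * gS G r)).
  { unfold v; form_expand; rewrite Hqq, Hq', (form_sym G q' q), <- Er; lra. }
  destruct (Req_dec (gS G r) 0) as [E | E].
  - destruct (unit_tangent_exists G q) as [w Hw].
    exists w; split; [exact Hw |].
    assert (Hv : v = (0, 0, 0))
      by (apply (null_tangent G q); [exact Hq | exact Hqv | rewrite Hvv, E; ring]).
    unfold circle; rewrite E; unfold v in Hv.
    clear - Hv. destruct q as [[? ?] ?], q' as [[? ?] ?], w as [[? ?] ?].
    unfold comb3 in *; injection Hv; intros.
    triple_eq; lra.
  - exists (scal3 (/ gS G r) v); split.
    + split; form_expand; [rewrite Hqv; ring | rewrite Hvv; field; exact E].
    + unfold circle, v.
      destruct q as [[? ?] ?], q' as [[? ?] ?].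
      unfold comb3, scal3; triple_eq; field; exact E.
Qed.

Lemma geodesic_height G T q sg ka w s :
  on_surface G q -> unit_tangent G q w ->
  height G (geodesic G T q sg ka w s) = T + s * sg.
Proof. intros Hq Hw; apply height_point, circle_on_surface; assumption. Qed.

Lemma geodesic_unit_proj G T q sg ka w s :
  on_surface G q -> unit_tangent G q w ->
  unit_proj G (geodesic G T q sg ka w s) = circle G q w (s * ka).
Proof. intros Hq Hw; apply unit_proj_point, circle_on_surface; assumption. Qed.

Lemma geodesic_to G T q w T' r L :
  0 < L -> 0 <= r -> L ^ 2 = (T' - T) ^ 2 + r ^ 2 ->
  direction ((T' - T) / L) (r / L) /\
  geodesic G T q ((T' - T) / L) (r / L) w L = point T' (circle G q w r).
Proof.
  intros HL Hr E; split.
  - split; [| apply Rdiv_le_0_compat; lra].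
    replace (_ + _) with (((T' - T) ^ 2 + r ^ 2) / L ^ 2) by (field; lra).
    rewrite <- E; field; lra.
  - unfold geodesic; f_equal; [field; lra |].
    f_equal; field; lra.
Qed.

Lemma path_between G P Q r :
  space G P -> space G Q -> separation G (unit_proj G P) (unit_proj G Q) r ->
  exists c L, unit_speed_path G c /\ 0 <= L /\
    L ^ 2 = (height G Q - height G P) ^ 2 + r ^ 2 /\ c 0 = P /\ c L = Q.
Proof.
  intros HP HQ Hr.
  pose proof (unit_proj_on_surface G P HP) as Hp.
  pose proof (unit_proj_on_surface G Q HQ) as Hq.
  destruct (circle_through G _ _ r Hp Hq Hr) as [w [Hw Ew]].
  pose proof (arc_range_nonneg _ _ (proj1 Hr)) as Hr0.
  set (T := height G P); set (T' := height G Q).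
  set (L := sqrt ((T' - T) ^ 2 + r ^ 2)).
  assert (HL : L ^ 2 = (T' - T) ^ 2 + r ^ 2)
    by (apply pow2_sqrt; generalize (pow2_ge_0 (T' - T)) (pow2_ge_0 r); lra).
  assert (HL0 : 0 <= L) by apply sqrt_pos.
  destruct (Req_dec L 0) as [E | E].
  - assert (T' = T) by nra. assert (r = 0) by nra.
    exists (geodesic G T (unit_proj G P) 1 0 w), L.
    assert (HPQ : P = Q).
    { rewrite <- (point_height_unit_proj G P HP), <- (point_height_unit_proj G Q HQ).
      fold T T'; rewrite <- Ew; subst r; rewrite circle_0; congruence. }
    split; [| split; [| split; [| split]]]; try assumption.
    + apply geodesic_unit_speed; [assumption | assumption | split; lra].
    + rewrite geodesic_0; now apply point_height_unit_proj.
    + rewrite E, geodesic_0, <- HPQ; now apply point_height_unit_proj.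
  - destruct (geodesic_to G T (unit_proj G P) w T' r L) as [Hd EL]; [lra | lra | lra |].
    exists (geodesic G T (unit_proj G P) ((T' - T) / L) (r / L) w), L.
    split; [| split; [| split; [| split]]]; try assumption.
    + now apply geodesic_unit_speed.
    + rewrite geodesic_0; now apply point_height_unit_proj.
    + rewrite EL, Ew; now apply point_height_unit_proj.
Qed.

Lemma preserves_metric_path G f c :
  preserves_metric G f -> unit_speed_path G c -> unit_speed_path G (fun s => f (c s)).
Proof.
  intros Hf Hc s; destruct (Hc s) as [Hs [w [Hw Hm]]].
  destruct (Hf (c s) Hs) as [Hfs [df [Hdf Hiso]]].
  split; [exact Hfs |]; exists (df w); split; [| now rewrite Hiso].
  apply filterdiff_ext_lin with (fun y : R => df (scal y w)).
  - apply (filterdiff_comp' c f); assumption.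
  - intros y; destruct Hdf as [Hl _]; apply (linear_scal df Hl).
Qed.

(** The bound [PI] on the parameter interval is where great circles cease to be
    shortest arcs. *)
Definition locally_minimizing (G : geometry) (c : R -> R3) : Prop :=
  forall s s' r, s <= s' <= s + PI ->
    separation G (unit_proj G (c s)) (unit_proj G (c s')) r ->
    (height G (c s') - height G (c s)) ^ 2 + r ^ 2 = (s' - s) ^ 2.

(** The upper bound is the length bound for the image path.  For the lower bound, a
    shorter path between two image points would be carried by the inverse isometry to
    a path that is too short for the endpoints on the original geodesic. *)
Lemma isometry_locally_minimizing G f T q sg ka w :
  isometry G f -> on_surface G q -> unit_tangent G q w -> direction sg ka ->
  unit_speed_path G (fun s => f (geodesic G T q sg ka w s)) /\
  locally_minimizing G (fun s => f (geodesic G T q sg ka w s)).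
Proof.
  intros [g [Hf [Hg [Hgf _]]]] Hq Hw Hd.
  pose proof (geodesic_unit_speed G T q sg ka w Hq Hw Hd) as Hb.
  pose proof (preserves_metric_path G f _ Hf Hb) as Hc.
  split; [exact Hc |]; intros s s' r Hs Hr.
  apply Rle_antisym.
  - now apply (path_length_bound G _ s s' r Hc).
  - destruct (path_between G _ _ r (proj1 (Hc s)) (proj1 (Hc s')) Hr)
      as [e [L [He [HL [EL [E0 E1]]]]]].
    rewrite <- EL.
    pose proof (preserves_metric_path G g _ Hg He) as Hge.
    destruct Hd as [Hd Hka].
    replace ((s' - s) ^ 2)
      with ((T + s' * sg - (T + s * sg)) ^ 2 + ((s' - s) * ka) ^ 2)
      by (transitivity ((s' - s) ^ 2 * (sg ^ 2 + ka ^ 2)); [ring | rewrite Hd; ring]).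
    assert (Hr' : separation G (unit_proj G (g (e 0))) (unit_proj G (g (e L))) ((s' - s) * ka)).
    { rewrite E0, E1, !Hgf by apply Hb.
      rewrite !geodesic_unit_proj by assumption.
      split.
      - apply arc_range_small; assert (ka <= 1) by nra. split; nra.
      - rewrite form_circle by assumption; f_equal; ring. }
    pose proof (path_length_bound G _ 0 L _ Hge HL Hr') as H.
    cbv beta in H; rewrite E0, E1, !Hgf in H by apply Hb.
    rewrite !geodesic_height in H by assumption.
    replace (L - 0) with L in H by ring. exact H.
Qed.

Lemma is_derive_zero_const (f : R -> R) :
  (forall s, is_derive f s 0) -> forall a b, f a = f b.
Proof.
  intros H a b.
  destruct (MVT_gen f b a (fun _ => 0)) as [x [_ E]].
  - intros s _; apply H.
  - intros s _; apply continuity_pt_filterlim, (ex_derive_continuous f); eexists; apply H.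
  - lra.
Qed.

(** Differentiating the functional equation in [s] and in [h] and adding the results
    expresses [y' (s + h)] by [y s] and [y' s].  Hence [y'] is itself differentiable,
    with [y'' = - k * ka ^ 2 * y], and the two expressions in the conclusion are the
    first integrals of this linear equation.  They also make sense for [ka = 0], where
    the second says that [y'] is constant. *)
Lemma cosine_equation G (y : R -> R) (ka : R) :
  (forall s, ex_derive y s) ->
  (forall s h, 0 <= h <= 1 -> y (s + h) + y (s - h) = 2 * gC G (ka * h) * y s) ->
  forall s,
    ka * gC G (ka * s) * y s - gS G (ka * s) * Derive y s = ka * y 0 /\
    curvature G * ka * gS G (ka * s) * y s + gC G (ka * s) * Derive y s = Derive y 0.
Proof.
  intros Hy Heq.
  assert (Hd : forall s, is_derive y s (Derive y s)) by (intros s; apply Derive_correct, Hy).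
  assert (Heven : forall s h, -1 <= h <= 1 -> y (s + h) + y (s - h) = 2 * gC G (ka * h) * y s).
  { intros s h Hh; destruct (Rle_dec 0 h); [apply Heq; lra |].
    rewrite <- (Ropp_involutive h), Ropp_mult_distr_r_reverse, gC_opp.
    rewrite <- Heq by lra.
    replace (s - - - h) with (s + - h) by ring.
    replace (s + - - h) with (s - - h) by ring. ring. }
  assert (HC : forall s, is_derive (fun h => gC G (ka * h)) s (ka * (- curvature G * gS G (ka * s)))).
  { intros s; apply is_derive_Rcomp; [apply is_derive_gC | auto_derive; [exact I | ring]]. }
  assert (HS : forall s, is_derive (fun h => gS G (ka * h)) s (ka * gC G (ka * s))).
  { intros s; apply is_derive_Rcomp; [apply is_derive_gS | auto_derive; [exact I | ring]]. }
  assert (Hshift : forall u s h, is_derive (fun s => y (s + h)) s (Derive y (s + h)) /\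
      is_derive (fun h => y (u + h)) h (Derive y (u + h)) /\
      is_derive (fun h => y (u - h)) h (- Derive y (u - h))).
  { intros u s h; split; [| split].
    - replace (Derive y (s + h)) with (1 * Derive y (s + h)) by ring.
      apply (is_derive_Rcomp y (fun s => s + h)); [apply Hd | auto_derive; [exact I | ring]].
    - replace (Derive y (u + h)) with (1 * Derive y (u + h)) by ring.
      apply (is_derive_Rcomp y (fun h => u + h)); [apply Hd | auto_derive; [exact I | ring]].
    - replace (- Derive y (u - h)) with (-1 * Derive y (u - h)) by ring.
      apply (is_derive_Rcomp y (fun h => u - h)); [apply Hd | auto_derive; [exact I | ring]]. }
  assert (Hconst : forall (z s : R), is_derive (fun _ : R => z) s 0)
    by (intros; apply @is_derive_const).
  assert (Hadd : forall s h, -1 < h < 1 ->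
    Derive y (s + h) = gC G (ka * h) * Derive y s
      - curvature G * ka * gS G (ka * h) * y s).
  { intros s h Hh.
    assert (E1 : Derive y (s + h) + Derive y (s + - h) = 2 * gC G (ka * h) * Derive y s).
    { transitivity (Derive (fun s => y (s + h) + y (s + - h)) s).
      - symmetry; apply is_derive_unique, is_derive_Rplus;
          [exact (proj1 (Hshift 0 s h)) | exact (proj1 (Hshift 0 s (- h)))].
      - rewrite (Derive_ext _ (fun s => 2 * gC G (ka * h) * y s))
          by (intros t; apply Heven; lra).
        apply is_derive_unique, is_derive_Rscal, Hd. }
    assert (E2 : Derive y (s + h) + - Derive y (s - h)
      = 2 * (ka * (- curvature G * gS G (ka * h)) * y s + gC G (ka * h) * 0)).
    { transitivity (Derive (fun h => y (s + h) + y (s - h)) h).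
      - symmetry; apply is_derive_unique, is_derive_Rplus;
          [exact (proj1 (proj2 (Hshift s 0 h))) | exact (proj2 (proj2 (Hshift s 0 h)))].
      - rewrite (Derive_ext_loc _ (fun h => 2 * (gC G (ka * h) * y s))).
        + apply is_derive_unique, is_derive_Rscal.
          apply (is_derive_Rmult (fun h => gC G (ka * h)) (fun _ => y s));
            [apply HC | apply Hconst].
        + apply (locally_interval _ h (-1) 1); simpl; [lra | lra |].
          intros t Ht1 Ht2; rewrite Heven by lra; ring. }
    unfold Rminus in E2. lra. }
  assert (Hdd : forall s, is_derive (Derive y) s (- curvature G * ka ^ 2 * y s)).
  { intros s.
    apply is_derive_ext_loc with (fun t => gC G (ka * (t - s)) * Derive y s
      - curvature G * ka * gS G (ka * (t - s)) * y s).
    - apply (locally_interval _ s (s - 1) (s + 1)); simpl; [lra | lra |].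
      intros t Ht1 Ht2; rewrite <- Hadd by lra; f_equal; ring.
    - assert (Hs : is_derive (fun t => t - s) s 1) by (auto_derive; [exact I | ring]).
      evar_last.
      + apply @is_derive_minus.
        * apply is_derive_Rmult; [| apply Hconst].
          apply (is_derive_Rcomp (fun h => gC G (ka * h)) (fun t => t - s)); [apply HC | exact Hs].
        * apply is_derive_Rmult; [| apply Hconst].
          apply is_derive_Rmult; [apply Hconst |].
          apply (is_derive_Rcomp (fun h => gS G (ka * h)) (fun t => t - s)); [apply HS | exact Hs].
      + rewrite Rminus_diag, Rmult_0_r, gC_0, gS_0.
        unfold minus, plus, opp; simpl; ring. }
  intros s; split.
  - rewrite (is_derive_zero_const
      (fun s => ka * gC G (ka * s) * y s - gS G (ka * s) * Derive y s)) with (b := 0).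
    + rewrite Rmult_0_r, gC_0, gS_0; ring.
    + intros t; evar_last.
      * apply @is_derive_minus; apply is_derive_Rmult;
          [apply is_derive_Rscal, HC | apply Hd | apply HS | apply Hdd].
      * unfold minus, plus, opp; simpl; ring.
  - rewrite (is_derive_zero_const
      (fun s => curvature G * ka * gS G (ka * s) * y s + gC G (ka * s) * Derive y s))
      with (b := 0).
    + rewrite Rmult_0_r, gC_0, gS_0; ring.
    + intros t; evar_last.
      * apply is_derive_Rplus; apply is_derive_Rmult;
          [apply is_derive_Rscal, HS | apply Hd | apply HC | apply Hdd].
      * simpl; ring.
Qed.

Lemma affine_of_derive_const (y : R -> R) (d : R) :
  (forall s, ex_derive y s) -> (forall s, Derive y s = d) -> forall s, y s = y 0 + s * d.
Proof.
  intros Hy Hd s.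
  assert (E : y s - d * s = y 0 - d * 0).
  { apply (is_derive_zero_const (fun s => y s - d * s)).
    intros t; evar_last.
    - apply @is_derive_minus; [apply Derive_correct, Hy |].
      apply is_derive_Rscal, @is_derive_id.
    - rewrite Hd; unfold minus, plus, opp, one; simpl; ring. }
  lra.
Qed.

(** Both first integrals combined, using [C ^ 2 + k * S ^ 2 = 1]. *)
Lemma cosine_equation_solution G (y : R -> R) (ka : R) :
  (forall s, ex_derive y s) ->
  (forall s h, 0 <= h <= 1 -> y (s + h) + y (s - h) = 2 * gC G (ka * h) * y s) ->
  forall s, ka * y s = ka * gC G (ka * s) * y 0 + gS G (ka * s) * Derive y 0.
Proof.
  intros Hy Heq s; destruct (cosine_equation G y ka Hy Heq s) as [E1 E2].
  transitivity (ka * y s * (gC G (ka * s) * gC G (ka * s)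
     + curvature G * (gS G (ka * s) * gS G (ka * s)))); [rewrite gC_gS; ring |].
  replace (ka * gC G (ka * s) * y 0) with (gC G (ka * s) * (ka * y 0)) by ring.
  rewrite <- E1, <- E2; ring.
Qed.

(** The vector [p + q - 2 * C r * m] is orthogonal to [m] and null, hence zero. *)
Lemma surface_midpoint G p m q r :
  on_surface G p -> on_surface G m -> on_surface G q ->
  gC G r = form G p m -> gC G r = form G m q -> gC G (r + r) = form G p q ->
  forall n, form G q n + form G p n = 2 * gC G r * form G m n.
Proof.
  intros [_ Hp] Hm [_ Hq] E1 E2 E3 n; pose proof (proj2 Hm) as Hmm.
  set (v := comb3 1 (comb3 1 p 1 q) (- (2 * gC G r)) m).
  assert (Hv : v = (0, 0, 0)).
  { apply (null_tangent G m); [exact Hm | |]; unfold v; form_expand.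
    - rewrite Hmm, (form_sym G m p), <- E1, <- E2; ring.
    - rewrite Hmm, Hp, Hq, (form_sym G m p), (form_sym G q p), (form_sym G q m), <- E1, <- E2,
        <- E3, gC_plus.
      generalize (gC_gS G r); intros; nra. }
  assert (E : form G v n = 0)
    by (rewrite Hv; destruct n as [[? ?] ?]; simpl; ring).
  unfold v in E; rewrite !form_comb_l in E; lra.
Qed.

(** The equality case of the triangle inequality for the product of a line and the
    unit surface, read off on the line. *)
Lemma equal_steps a1 a2 r1 r2 r h :
  0 <= r -> 0 <= r1 -> 0 <= r2 -> r <= r1 + r2 ->
  a1 ^ 2 + r1 ^ 2 = h ^ 2 -> a2 ^ 2 + r2 ^ 2 = h ^ 2 -> (a1 + a2) ^ 2 + r ^ 2 = (2 * h) ^ 2 ->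
  a1 = a2.
Proof.
  intros H0 H1 H2 Hr E1 E2 E3.
  assert (r ^ 2 <= (r1 + r2) ^ 2) by (apply pow_incr; lra).
  assert ((a1 - a2) ^ 2 <= 0) by (generalize (pow2_ge_0 (r1 - r2)); lra).
  nra.
Qed.

(** Equality in the triangle inequality makes the height affine with some slope [sg].
    What remains of the length shows that the projection advances by the separation
    [ka * h] in time [h], so that it satisfies the midpoint equation.  The direction [w]
    is read off from the position of the projection at time [1], which is neither
    equal nor antipodal to the initial position if [ka > 0], since [ka <= 1 < PI]. *)
Lemma locally_minimizing_geodesic G c :
  unit_speed_path G c -> locally_minimizing G c ->
  exists sg ka w, direction sg ka /\ unit_tangent G (unit_proj G (c 0)) w /\
    forall s, c s = geodesic G (height G (c 0)) (unit_proj G (c 0)) sg ka w s.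
Proof.
  intros Hc Hmin.
  set (t := fun s => height G (c s)); set (Q := fun s => unit_proj G (c s)).
  assert (HQ : forall s, on_surface G (Q s))
    by (intros s; apply unit_proj_on_surface, Hc).
  assert (Hpi : 2 < PI) by (generalize PI2_1; lra).
  assert (Ht : forall s, ex_derive t s).
  { intros s; destruct (Hc s) as [Hs [w [Hw _]]].
    eexists; apply (is_derive_height G c s w); assumption. }
  assert (HQd : forall n s, ex_derive (fun s => form G (Q s) n) s).
  { intros n s; destruct (Hc s) as [Hs [w [Hw _]]].
    eexists; apply (is_derive_unit_proj_form G c s w n); assumption. }
  assert (Htmid : forall s h, 0 <= h <= 1 -> t (s + h) + t (s - h) = 2 * gC G (0 * h) * t s).
  { intros s h Hh; rewrite Rmult_0_l, gC_0.
    destruct (separation_exists G _ _ (HQ (s - h)) (HQ s)) as [r1 S1].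
    destruct (separation_exists G _ _ (HQ s) (HQ (s + h))) as [r2 S2].
    destruct (separation_exists G _ _ (HQ (s - h)) (HQ (s + h))) as [r S].
    pose proof (separation_triangle G _ _ _ _ _ _ (HQ (s - h)) (HQ s) (HQ (s + h)) S1 S2 S).
    pose proof (Hmin (s - h) s r1 ltac:(lra) S1) as E1.
    pose proof (Hmin s (s + h) r2 ltac:(lra) S2) as E2.
    pose proof (Hmin (s - h) (s + h) r ltac:(lra) S) as E.
    fold (t s) (t (s - h)) (t (s + h)) in E1, E2, E.
    assert (t s - t (s - h) = t (s + h) - t s); [| lra].
    apply (equal_steps _ _ r1 r2 r h); [| | | assumption | | |];
      try (apply (arc_range_nonneg G); apply S1 || apply S2 || apply S).
    - rewrite E1; f_equal; ring.
    - rewrite E2; f_equal; ring.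
    - replace (2 * h) with (s + h - (s - h)) by ring. rewrite <- E; f_equal; f_equal; ring. }
  set (sg := Derive t 0).
  assert (Haff : forall s, t s = t 0 + s * sg).
  { apply affine_of_derive_const; [exact Ht |]; intros s.
    destruct (cosine_equation G t 0 Ht Htmid s) as [_ E].
    rewrite !Rmult_0_l, gC_0, gS_0 in E; unfold sg; lra. }
  assert (Hsg : sg ^ 2 <= 1).
  { destruct (separation_exists G _ _ (HQ 0) (HQ 1)) as [r S].
    pose proof (Hmin 0 1 r ltac:(lra) S) as E.
    fold (t 0) (t 1) in E; rewrite (Haff 1) in E.
    replace ((t 0 + 1 * sg - t 0) ^ 2) with (sg ^ 2) in E by ring.
    generalize (pow2_ge_0 r); lra. }
  set (ka := sqrt (1 - sg ^ 2)).
  assert (Hka : ka ^ 2 = 1 - sg ^ 2) by (apply pow2_sqrt; lra).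
  assert (Hka0 : 0 <= ka) by apply sqrt_pos.
  assert (Hsep : forall s s', s <= s' <= s + PI -> separation G (Q s) (Q s') (ka * (s' - s))).
  { intros s s' Hs.
    destruct (separation_exists G _ _ (HQ s) (HQ s')) as [r S].
    pose proof (Hmin _ _ r Hs S) as E.
    pose proof (arc_range_nonneg _ _ (proj1 S)).
    fold (t s) (t s') in E; rewrite (Haff s), (Haff s') in E.
    replace (ka * (s' - s)) with r; [exact S |].
    assert (0 <= ka * (s' - s)) by (apply Rmult_le_pos; lra).
    apply Rsqr_inj; [assumption | assumption |].
    rewrite !Rsqr_pow2, Rpow_mult_distr, Hka; lra. }
  assert (HQmid : forall n s h, 0 <= h <= 1 ->
    form G (Q (s + h)) n + form G (Q (s - h)) n = 2 * gC G (ka * h) * form G (Q s) n).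
  { intros n s h Hh; apply surface_midpoint; try apply HQ.
    - destruct (Hsep (s - h) s ltac:(lra)) as [_ E]; rewrite <- E; f_equal; ring.
    - destruct (Hsep s (s + h) ltac:(lra)) as [_ E]; rewrite <- E; f_equal; ring.
    - destruct (Hsep (s - h) (s + h) ltac:(lra)) as [_ E]; rewrite <- E; f_equal; ring. }
  destruct (circle_through G (Q 0) (Q 1) (ka * (1 - 0)) (HQ 0) (HQ 1) (Hsep 0 1 ltac:(lra)))
    as [w [Hw Ew]].
  exists sg, ka, w; split; [split; lra |]; split; [exact Hw |].
  intros s; rewrite <- (point_height_unit_proj G (c s)) by apply Hc.
  unfold geodesic; fold (t s) (t 0) (Q s) (Q 0); rewrite (Haff s); f_equal.
  (* The vector equation is solved coordinate by coordinate, after pairing with an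
     arbitrary vector n. *)
  apply (form_nondegenerate G); intros n.
  set (y := fun s : R => form G (Q s) n).
  pose proof (cosine_equation_solution G y ka (HQd n) (HQmid n)) as Hsol.
  unfold circle; rewrite form_comb_l, (Rmult_comm s).
  change (y s = gC G (ka * s) * y 0 + gS G (ka * s) * form G w n).
  destruct (Rle_lt_or_eq_dec 0 ka Hka0) as [Hk | Hk].
  - assert (E1 : y 1 = gC G (ka * 1) * y 0 + gS G (ka * 1) * form G w n).
    { unfold y; rewrite <- Ew; unfold circle; rewrite Rminus_0_r; apply form_comb_l. }
    assert (HS : 0 < gS G (ka * 1)).
    { rewrite Rmult_1_r.
      assert (ka <= 1) by nra.
      destruct G; simpl; [apply sin_gt_0; lra |].
      rewrite <- sinh_0; now apply sinh_increasing. }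
    pose proof (Hsol 1) as H1; rewrite E1 in H1.
    assert (Hd : Derive y 0 = ka * form G w n)
      by (apply (Rmult_eq_reg_l (gS G (ka * 1))); lra).
    apply (Rmult_eq_reg_l ka); [| lra].
    rewrite Hsol, Hd; ring.
  - rewrite <- Hk, !Rmult_0_l, gC_0, gS_0 in *.
    assert (Hd : forall s, Derive y s = Derive y 0).
    { intros u.
      destruct (cosine_equation G y 0 (HQd n) (HQmid n) u) as [_ E].
      rewrite !Rmult_0_l, gC_0, gS_0 in E; lra. }
    assert (E1 : y 1 = y 0).
    { unfold y; rewrite <- Ew; unfold circle.
      rewrite gC_0, gS_0, form_comb_l; ring. }
    pose proof (affine_of_derive_const y _ (HQd n) Hd) as A.
    pose proof (A 1); rewrite (A s); replace (Derive y 0) with 0 by lra; ring.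
Qed.

(** * Translation curves *)

Lemma origin_on_surface G : on_surface G origin.
Proof.
  split; [| simpl; ring].
  destruct G; simpl; [intros E; injection E; lra | lra].
Qed.

Lemma is_linear_coords (f1 f2 f3 : R -> R -> R -> R) :
  (forall f, f = f1 \/ f = f2 \/ f = f3 ->
     exists a b c, forall x y z, f x y z = a * x + b * y + c * z) ->
  is_linear (fun p : R3 => let '(x, y, z) := p in (f1 x y z, f2 x y z, f3 x y z) : R3).
Proof.
  intros H.
  assert (Hl : forall f, f = f1 \/ f = f2 \/ f = f3 ->
    is_linear (fun p : R3 => f (fst (fst p)) (snd (fst p)) (snd p) : R)).
  { intros f Hf; destruct (H f Hf) as [a [b [c E]]].
    assert (L1 : is_linear (fun p : R3 => fst (fst p)))
      by (apply (is_linear_comp (fun p : R3 => fst p) (fun p => fst p)); apply is_linear_fst).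
    assert (L2 : is_linear (fun p : R3 => snd (fst p)))
      by (apply (is_linear_comp (fun p : R3 => fst p) (fun p => snd p));
          [apply is_linear_fst | apply is_linear_snd]).
    assert (L3 : is_linear (fun p : R3 => snd p)) by apply is_linear_snd.
    assert (Hs : forall (k : R) (l : R3 -> R), is_linear l -> is_linear (fun p => k * l p)).
    { intros k l Hlin; apply (is_linear_comp l (fun y : R => k * y)); [exact Hlin |].
      apply (is_linear_scal_r (V := R_NormedModule) k), Rmult_comm. }
    assert (Hp : forall l m : R3 -> R, is_linear l -> is_linear m ->
        is_linear (fun p => l p + m p)).
    { intros l m Hlin Hm.
      apply (is_linear_comp (fun p => (l p, m p)) (fun y : R * R => fst y + snd y));
        [now apply is_linear_prod | apply (is_linear_plus (V := R_NormedModule))]. }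
    apply is_linear_ext with (fun p : R3 => a * fst (fst p) + b * snd (fst p) + c * snd p).
    - intros p; now rewrite E.
    - repeat apply Hp; now apply Hs. }
  apply is_linear_ext with (fun p : R3 =>
    (f1 (fst (fst p)) (snd (fst p)) (snd p), f2 (fst (fst p)) (snd (fst p)) (snd p),
     f3 (fst (fst p)) (snd (fst p)) (snd p))).
  - intros [[x y] z]; reflexivity.
  - apply is_linear_prod; [apply is_linear_prod |]; apply Hl; tauto.
Qed.

(** For [k = 2 / form n n] this is the orthogonal reflection along [n]; [k = 0] gives
    the identity, which is needed when the two points to be exchanged coincide. *)
Definition reflect (G : geometry) (k : R) (n p : R3) : R3 := comb3 1 p (- k * form G p n) n.

Lemma is_linear_scal_reflect G m k n :
  is_linear (fun p : R3 => scal3 m (reflect G k n p) : R3).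
Proof.
  destruct n as [[n1 n2] n3].
  set (f := fun (u v w d : R) (x y z : R) =>
    m * (1 * (u * x + v * y + w * z)
         + - k * (x * n1 + curvature G * (y * n2 + z * n3)) * d)).
  apply is_linear_ext with (fun p : R3 => let '(x, y, z) := p in
    (f 1 0 0 n1 x y z, f 0 1 0 n2 x y z, f 0 0 1 n3 x y z) : R3).
  - intros [[x y] z]; unfold f, reflect, scal3, comb3, form.
    triple_eq; ring.
  - apply is_linear_coords.
    assert (Hf : forall u v w d, exists a b c, forall x y z,
        f u v w d x y z = a * x + b * y + c * z).
    { intros u v w d.
      exists (m * (u - k * n1 * d)), (m * (v - k * curvature G * n2 * d)),
        (m * (w - k * curvature G * n3 * d)).
      intros; unfold f; ring. }
    intros g [-> | [-> | ->]]; apply Hf.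
Qed.

(** The reflection along [origin - q] exchanges [origin] and [q]. *)
Lemma reflection_exists G q :
  on_surface G q ->
  exists k n, reflect G k n origin = q /\ (forall p, reflect G k n (reflect G k n p) = p) /\
    forall p p', form G (reflect G k n p) (reflect G k n p') = form G p p'.
Proof.
  intros Hq; pose proof (proj2 Hq) as Hqq.
  pose proof (origin_on_surface G) as Ho; pose proof (proj2 Ho) as Hoo.
  set (n := comb3 1 origin (-1) q).
  assert (Hnn : form G n n = 2 * (1 - form G origin q))
    by (unfold n; form_expand; rewrite Hoo, Hqq, (form_sym G q origin); ring).
  destruct (Req_dec (form G origin q) 1) as [E | E].
  - exists 0, n.
    assert (Hid : forall p, reflect G 0 n p = p).
    { intros [[? ?] ?]; unfold reflect; destruct n as [[? ?] ?]; unfold comb3.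
      triple_eq; ring. }
    assert (Hv : n = (0, 0, 0)).
    { apply (null_tangent G origin); [exact Ho | | rewrite Hnn, E; ring].
      unfold n; form_expand; rewrite Hoo, E; ring. }
    split; [| split; intros; now rewrite !Hid].
    rewrite Hid. unfold n in Hv; destruct q as [[? ?] ?].
    unfold comb3, origin in *; injection Hv; intros; triple_eq; lra.
  - exists (2 / form G n n), n.
    assert (Hn0 : form G n n <> 0) by (rewrite Hnn; lra).
    split; [| split].
    + unfold reflect.
      replace (- (2 / form G n n) * form G origin n) with (-1).
      * unfold n; destruct q as [[? ?] ?]; unfold comb3, origin.
        triple_eq; ring.
      * rewrite Hnn; unfold n; form_expand; rewrite Hoo; field; lra.
    + intros p; unfold reflect; form_expand.
      set (x := form G p n); set (z := form G n n) in *.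
      replace (- (2 / z) * (1 * x + - (2 / z) * x * z)) with (2 / z * x) by (field; exact Hn0).
      destruct p as [[? ?] ?], n as [[? ?] ?]; unfold comb3.
      triple_eq; field; exact Hn0.
    + intros p p'; unfold reflect; form_expand.
      rewrite (form_sym G n p'); field; exact Hn0.
Qed.

(** The metric is expressed by the form alone and is invariant under scaling.  In the
    hyperbolic case the right nappe of the cone is preserved because [origin] is sent to
    a point of it. *)
Lemma preserves_metric_scal_reflect G q m k n :
  0 < m -> on_surface G q -> reflect G k n origin = q ->
  (forall p p', form G (reflect G k n p) (reflect G k n p') = form G p p') ->
  preserves_metric G (fun p => scal3 m (reflect G k n p)).
Proof.
  intros Hm Hq Ho Hform.
  assert (Hspace : forall p, space G p -> space G (reflect G k n p)).
  { intros p Hp; apply (space_of_timelike G q); [apply Hq | |].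
    - rewrite Hform; now apply space_form_pos.
    - intros ->; rewrite <- Ho, Hform.
      destruct p as [[x y] z]; destruct Hp as [Hx _]; simpl in *; lra. }
  intros p Hp; split; [apply space_scal3; auto |].
  exists (fun u => scal3 m (reflect G k n u)); split.
  - apply filterdiff_linear, is_linear_scal_reflect.
  - intros u w; rewrite metric_scal3; [| lra | auto].
    unfold metric, surface_part, fibre_part; form_expand; rewrite !Hform; form_expand.
    reflexivity.
Qed.

Lemma scal_reflect_isometry G q m k n :
  0 < m -> on_surface G q -> reflect G k n origin = q ->
  (forall p, reflect G k n (reflect G k n p) = p) ->
  (forall p p', form G (reflect G k n p) (reflect G k n p') = form G p p') ->
  isometry G (fun p => scal3 m (reflect G k n p)).
Proof.
  intros Hm Hq Ho Hinv Hform.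
  assert (Hlin : forall c p, reflect G k n (scal3 c p) = scal3 c (reflect G k n p)).
  { intros c p; unfold reflect; form_expand.
    destruct p as [[? ?] ?], n as [[? ?] ?]; unfold comb3, scal3.
    triple_eq; ring. }
  assert (Hscal : forall a b p, a * b = 1 -> scal3 a (scal3 b p) = p).
  { intros a b [[x y] z] Hab; unfold scal3.
    triple_eq; rewrite <- Rmult_assoc, Hab; ring. }
  exists (fun p => scal3 (/ m) (reflect G k n p)).
  split; [| split; [| split]].
  - apply (preserves_metric_scal_reflect G q); assumption.
  - apply (preserves_metric_scal_reflect G q); try assumption.
    now apply Rinv_0_lt_compat.
  - intros p _; rewrite Hlin, Hinv; apply Hscal; field; lra.
  - intros p _; rewrite Hlin, Hinv; apply Hscal; field; lra.
Qed.

Lemma base_curve_geodesic G u v tau :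
  base_curve G u v tau = geodesic G 0 origin (sin v) (cos v) (0, cos u, sin u) tau.
Proof.
  unfold base_curve, geodesic, point, circle, comb3, scal3, origin.
  rewrite Rplus_0_l; triple_eq; ring.
Qed.

Lemma base_direction_unit G u : unit_tangent G origin (0, cos u, sin u).
Proof.
  generalize (sin2_cos2 u); unfold Rsqr.
  split; unfold form, origin; [ring |].
  rewrite <- (Rmult_1_r (curvature G)) at 2; rewrite <- H; ring.
Qed.

Definition geodesic_from (G : geometry) (P : R3) : R -> R -> R3 -> R -> R3 :=
  geodesic G (height G P) (unit_proj G P).

(** Isometries send geodesics to geodesics, by the metric characterization. *)
Lemma translation_curve_is_geodesic G P c :
  translation_curve G P c ->
  exists sg ka w, direction sg ka /\ unit_tangent G (unit_proj G P) w /\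
    forall tau, c tau = geodesic_from G P sg ka w tau.
Proof.
  intros [f [u [v [Hf [HP [Hu [Hv Hc]]]]]]].
  assert (Hd : direction (sin v) (cos v)).
  { split; [generalize (sin2_cos2 v); unfold Rsqr; lra | apply cos_ge_0; lra]. }
  destruct (isometry_locally_minimizing G f 0 origin (sin v) (cos v) (0, cos u, sin u)
    Hf (origin_on_surface G) (base_direction_unit G u) Hd) as [H1 H2].
  destruct (locally_minimizing_geodesic G _ H1 H2) as [sg [ka [w [Hd' [Hw E]]]]].
  assert (E0 : f (geodesic G 0 origin (sin v) (cos v) (0, cos u, sin u) 0) = P)
    by (rewrite <- base_curve_geodesic, <- Hc, Hc, base_curve_geodesic, geodesic_0;
        unfold point; rewrite exp_0; unfold scal3, origin; rewrite <- HP;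
        f_equal; unfold origin; triple_eq; ring).
  rewrite E0 in *.
  exists sg, ka, w; split; [exact Hd' |]; split; [exact Hw |].
  intros tau; rewrite Hc, base_curve_geodesic; apply E.
Qed.

Lemma circle_angle (b c : R) :
  b ^ 2 + c ^ 2 = 1 -> exists u, - PI < u <= PI /\ cos u = b /\ sin u = c.
Proof.
  intros H; assert (Hb : -1 <= b <= 1) by nra.
  pose proof (acos_bound b) as Hab; pose proof (cos_acos b Hb) as Hcb.
  pose proof (sin2_cos2 (acos b)) as Hs; unfold Rsqr in Hs; rewrite Hcb in Hs.
  pose proof (sin_ge_0 (acos b) (proj1 Hab) (proj2 Hab)) as Hsp.
  pose proof PI_RGT_0.
  destruct (Rle_dec 0 c) as [Hc | Hc].
  - exists (acos b); split; [lra |]; split; [exact Hcb | nra].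
  - exists (- acos b); rewrite cos_neg, sin_neg; split; [| split; [exact Hcb | nra]].
    split; [| lra].
    destruct (Req_dec (acos b) PI) as [E | E]; [| lra].
    rewrite E, cos_PI in Hcb; nra.
Qed.

(** The linear isometry exchanging [origin] and the projection of [P] pulls the
    direction [w] back to a horizontal unit vector at [origin], which is
    [(0, cos u, sin u)] for some angle [u]; the angle [v] is [asin sg]. *)
Lemma geodesic_is_translation_curve G P sg ka w :
  space G P -> direction sg ka -> unit_tangent G (unit_proj G P) w ->
  translation_curve G P (geodesic_from G P sg ka w).
Proof.
  intros HP [Hd Hka] [Hqw Hww].
  pose proof (unit_proj_on_surface G P HP) as Hq.
  destruct (reflection_exists G _ Hq) as [k [n [Ho [Hinv Hform]]]].
  set (w0 := reflect G k n w).
  assert (E1 : form G origin w0 = 0)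
    by (unfold w0; rewrite <- (Hinv origin), Hform, Ho; exact Hqw).
  assert (E2 : form G w0 w0 = curvature G) by (unfold w0; rewrite Hform; exact Hww).
  assert (E3 : w = reflect G k n w0) by (unfold w0; now rewrite Hinv).
  destruct w0 as [[a b] c]; unfold origin in E1; simpl in E1.
  assert (a = 0) by lra; subst a.
  destruct (circle_angle b c) as [u [Hu [Ecos Esin]]]; [destruct G; simpl in E2; lra |].
  assert (Hsg : -1 <= sg <= 1) by nra.
  exists (fun p => scal3 (exp (height G P)) (reflect G k n p)), u, (asin sg).
  split; [apply (scal_reflect_isometry G (unit_proj G P)); auto using exp_pos |].
  split; [rewrite Ho; now apply point_height_unit_proj |].
  split; [exact Hu |].
  split; [apply asin_bound |].
  intros tau; rewrite base_curve_geodesic, sin_asin by exact Hsg.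
  replace (cos (asin sg)) with ka.
  2: { rewrite cos_asin by exact Hsg; symmetry; unfold Rsqr.
       replace (1 - sg * sg) with (ka * ka) by lra; now apply sqrt_square. }
  unfold geodesic_from, geodesic, point.
  rewrite Ecos, Esin, E3, <- Ho.
  rewrite Rplus_0_l, exp_plus.
  unfold reflect, circle; form_expand.
  unfold origin; destruct n as [[? ?] ?]; unfold comb3, scal3.
  triple_eq; ring.
Qed.

Lemma joins_geodesic G P A c L :
  joins G P A c L ->
  exists sg ka w, direction sg ka /\ unit_tangent G (unit_proj G P) w /\
    (forall tau, c tau = geodesic_from G P sg ka w tau) /\ 0 <= L /\
    geodesic_from G P sg ka w L = A.
Proof.
  intros [Hc [HL E]].
  destruct (translation_curve_is_geodesic G P c Hc) as [sg [ka [w [Hd [Hw Hcw]]]]].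
  exists sg, ka, w; repeat (split; [assumption |]); now rewrite <- Hcw.
Qed.

Lemma geodesic_joins G P A sg ka w L :
  space G P -> direction sg ka -> unit_tangent G (unit_proj G P) w -> 0 <= L ->
  geodesic_from G P sg ka w L = A -> joins G P A (geodesic_from G P sg ka w) L.
Proof.
  intros HP Hd Hw HL E; split; [now apply geodesic_is_translation_curve | now split].
Qed.

Lemma geodesic_endpoint G P A sg ka w L :
  space G P -> space G A -> unit_tangent G (unit_proj G P) w ->
  (geodesic_from G P sg ka w L = A <->
   height G P + L * sg = height G A /\
   circle G (unit_proj G P) w (L * ka) = unit_proj G A).
Proof.
  intros HP HA Hw; pose proof (unit_proj_on_surface G P HP) as Hq.
  pose proof (unit_proj_on_surface G A HA) as HqA.
  unfold geodesic_from, geodesic; split.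
  - intros E; apply (point_inj G); [now apply circle_on_surface | assumption |].
    rewrite E; symmetry; now apply point_height_unit_proj.
  - intros [-> ->]; now apply point_height_unit_proj.
Qed.

Lemma height_on_surface G q : on_surface G q -> height G q = 0.
Proof. intros [_ Hq]; unfold height, norm3; rewrite Hq, sqrt_1; apply ln_1. Qed.

Lemma unit_proj_id G q : on_surface G q -> unit_proj G q = q.
Proof.
  intros [_ Hq]; unfold unit_proj, norm3; rewrite Hq, sqrt_1.
  destruct q as [[x y] z]; unfold scal3; triple_eq; field.
Qed.

(** * Lifting and projecting shortest curves *)

(** The curve is the hypotenuse of a right triangle whose legs are the height difference
    and the arc on the surface; [P <> A] excludes the degenerate triangle, which has no
    direction. *)
Lemma geodesic_connects G P A w r :
  space G P -> space G A -> P <> A -> unit_tangent G (unit_proj G P) w -> 0 <= r ->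
  circle G (unit_proj G P) w r = unit_proj G A ->
  exists L sg ka, 0 < L /\ direction sg ka /\
    L * sg = height G A - height G P /\ L * ka = r /\
    L ^ 2 = (height G A - height G P) ^ 2 + r ^ 2 /\
    joins G P A (geodesic_from G P sg ka w) L.
Proof.
  intros HP HA Hne Hw Hr E.
  set (dt := height G A - height G P).
  set (L := sqrt (dt ^ 2 + r ^ 2)).
  assert (HL : L ^ 2 = dt ^ 2 + r ^ 2)
    by (apply pow2_sqrt; generalize (pow2_ge_0 dt) (pow2_ge_0 r); lra).
  assert (HL0 : 0 <= L) by apply sqrt_pos.
  assert (HLp : 0 < L).
  { destruct (Req_dec L 0) as [E0 | E0]; [exfalso; apply Hne | lra].
    assert (dt = 0) by nra. assert (r = 0) by nra. subst r.
    rewrite circle_0 in E.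
    rewrite <- (point_height_unit_proj G P HP), <- (point_height_unit_proj G A HA), E.
    f_equal; unfold dt in *; lra. }
  destruct (geodesic_to G (height G P) (unit_proj G P) w (height G A) r L HLp Hr HL)
    as [Hd El].
  exists L, (dt / L), (r / L).
  split; [exact HLp |]; split; [exact Hd |]; split; [field; lra |]; split; [field; lra |].
  split; [exact HL |].
  apply geodesic_joins; try assumption.
  unfold geodesic_from; fold dt in El; rewrite El, E; now apply point_height_unit_proj.
Qed.

Lemma horizontal_joins G q q' w r :
  on_surface G q -> on_surface G q' -> unit_tangent G q w -> 0 <= r ->
  circle G q w r = q' -> joins G q q' (geodesic_from G q 0 1 w) r.
Proof.
  intros Hq Hq' Hw Hr E.
  apply geodesic_joins; try assumption; [apply Hq | split; lra | now rewrite unit_proj_id |].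
  unfold geodesic_from, geodesic.
  rewrite height_on_surface, unit_proj_id, Rmult_1_r, E by assumption.
  rewrite Rmult_0_r, Rplus_0_r; unfold point; rewrite exp_0.
  destruct q' as [[x y] z]; unfold scal3; triple_eq; ring.
Qed.

(** A curve joining two points of the unit surface is horizontal or has length [0].  In
    the second case its direction is arbitrary, and only the products with the length
    are determined. *)
Lemma surface_joins G q q' c d :
  on_surface G q -> on_surface G q' -> joins G q q' c d ->
  exists sg ka w, direction sg ka /\ unit_tangent G q w /\
    (forall tau, c tau = geodesic_from G q sg ka w tau) /\ 0 <= d /\
    d * sg = 0 /\ d * ka = d /\ circle G q w d = q'.
Proof.
  intros Hq Hq' Hj.
  destruct (joins_geodesic G q q' c d Hj) as [sg [ka [w [[Hd Hka] [Hw [Hc [Hd0 E]]]]]]].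
  apply geodesic_endpoint in E; [| apply Hq | apply Hq' | exact Hw].
  rewrite !height_on_surface, !unit_proj_id in * by assumption.
  destruct E as [E1 E2].
  assert (Hs : d * sg = 0) by lra.
  assert (Hk : d * ka = d).
  { destruct (Req_dec d 0) as [-> | Hne]; [ring |].
    assert (sg = 0) by (apply (Rmult_eq_reg_l d); lra).
    assert (ka = 1) by nra. subst ka; ring. }
  rewrite Hk in E2.
  exists sg, ka, w; repeat (split; [assumption || (split; assumption) |]); exact E2.
Qed.

(** The fibre leg of the right triangle is the same for all curves from [P] to [A], so
    the hypotenuse is shortest exactly when the leg on the surface is. *)
Lemma project_shortest G P A c L :
  space G P -> space G A -> P <> A -> shortest G P A c L ->
  exists sg ka w, direction sg ka /\ unit_tangent G (unit_proj G P) w /\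
    (forall tau, c tau = geodesic_from G P sg ka w tau) /\ 0 < L /\
    L * sg = height G A - height G P /\
    shortest G (unit_proj G P) (unit_proj G A)
      (geodesic_from G (unit_proj G P) 0 1 w) (L * ka).
Proof.
  intros HP HA Hne [Hj Hmin].
  pose proof (unit_proj_on_surface G P HP) as Hq.
  pose proof (unit_proj_on_surface G A HA) as HqA.
  destruct (joins_geodesic G P A c L Hj) as [sg [ka [w [[Hd Hka] [Hw [Hc [HL E]]]]]]].
  apply geodesic_endpoint in E; try assumption; destruct E as [E1 E2].
  assert (HLp : 0 < L).
  { destruct (Req_dec L 0) as [-> | E0]; [exfalso; apply Hne | lra].
    destruct Hj as [_ [_ Hj]]; rewrite <- Hj, Hc; unfold geodesic_from.
    rewrite geodesic_0; symmetry; now apply point_height_unit_proj. }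
  exists sg, ka, w; repeat (split; [assumption || (split; assumption) || lra |]).
  split.
  - apply horizontal_joins; try assumption; now apply Rmult_le_pos.
  - intros c' d Hj'.
    destruct (surface_joins G _ _ c' d Hq HqA Hj')
      as [_ [_ [w' [_ [Hw' [_ [Hd0 [_ [_ E']]]]]]]]].
    destruct (geodesic_connects G P A w' d HP HA Hne Hw' Hd0 E')
      as [L' [sg' [ka' [HL' [_ [_ [_ [Esq Hj'']]]]]]]].
    pose proof (Hmin _ _ Hj'') as Hle.
    assert (H : (L * ka) ^ 2 <= d ^ 2).
    { assert (L ^ 2 <= L' ^ 2) by (apply pow_incr; lra).
      assert (L ^ 2 = (height G A - height G P) ^ 2 + (L * ka) ^ 2)
        by (replace (height G A - height G P) with (L * sg) by lra;
            transitivity (L ^ 2 * (sg ^ 2 + ka ^ 2)); [rewrite Hd; ring | ring]).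
      lra. }
    apply Rsqr_incr_0; [rewrite !Rsqr_pow2; exact H | now apply Rmult_le_pos | exact Hd0].
Qed.

(** The converse of [project_shortest].  The curve on the surface may have length [0]
    and hence any slope, so its direction [(sg', ka')] is recorded only up to
    multiplication by [d]. *)
Lemma lift_shortest G P A c d :
  space G P -> space G A -> P <> A ->
  shortest G (unit_proj G P) (unit_proj G A) c d ->
  exists sg' ka' w, direction sg' ka' /\ unit_tangent G (unit_proj G P) w /\
    (forall tau, c tau = geodesic_from G (unit_proj G P) sg' ka' w tau) /\
    d * sg' = 0 /\ d * ka' = d /\
    exists L sg ka, 0 < L /\ direction sg ka /\
      L * sg = height G A - height G P /\ L * ka = d /\
      shortest G P A (geodesic_from G P sg ka w) L.
Proof.
  intros HP HA Hne [Hj Hmin].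
  pose proof (unit_proj_on_surface G P HP) as Hq.
  pose proof (unit_proj_on_surface G A HA) as HqA.
  destruct (surface_joins G _ _ c d Hq HqA Hj)
    as [sg' [ka' [w [Hd [Hw [Hc [Hd0 [Hs [Hk E]]]]]]]]].
  exists sg', ka', w; repeat (split; [assumption |]).
  destruct (geodesic_connects G P A w d HP HA Hne Hw Hd0 E)
    as [L [sg [ka [HL [Hdir [E1 [E2 [Esq HjL]]]]]]]].
  exists L, sg, ka; repeat (split; [assumption |]).
  intros c' L' Hj'.
  destruct (joins_geodesic G P A c' L' Hj')
    as [sg2 [ka2 [w2 [[Hd2 Hka2] [Hw2 [_ [HL' E']]]]]]].
  apply geodesic_endpoint in E'; try assumption; destruct E' as [F1 F2].
  assert (Hle : d <= L' * ka2).
  { apply (Hmin (geodesic_from G (unit_proj G P) 0 1 w2)).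
    apply horizontal_joins; try assumption; now apply Rmult_le_pos. }
  assert (d ^ 2 <= (L' * ka2) ^ 2) by (apply pow_incr; lra).
  assert (L' ^ 2 = (height G A - height G P) ^ 2 + (L' * ka2) ^ 2)
    by (replace (height G A - height G P) with (L' * sg2) by lra;
        transitivity (L' ^ 2 * (sg2 ^ 2 + ka2 ^ 2)); [rewrite Hd2; ring | ring]).
  apply Rsqr_incr_0; rewrite ?Rsqr_pow2; lra.
Qed.

(** * Angles *)

Lemma is_derive_R3_unique (c : R -> R3) s (w w' : R3) :
  is_derive c s w -> is_derive c s w' -> w = w'.
Proof.
  intros H H'.
  destruct (is_derive_components c s w H) as [A1 [A2 A3]].
  destruct (is_derive_components c s w' H') as [B1 [B2 B3]].
  apply is_derive_unique in A1, A2, A3, B1, B2, B3.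
  destruct w as [[? ?] ?], w' as [[? ?] ?]; simpl in *.
  triple_eq; congruence.
Qed.

Definition initial_velocity (G : geometry) (P : R3) (sg ka : R) (w : R3) : R3 :=
  scal3 (exp (height G P)) (comb3 sg (unit_proj G P) 1 (scal3 ka w)).

Lemma is_derive_geodesic_from G P sg ka w :
  is_derive (geodesic_from G P sg ka w) 0 (initial_velocity G P sg ka w).
Proof.
  evar_last; [apply is_derive_geodesic |].
  unfold initial_velocity, circle, circle_tangent.
  rewrite !Rmult_0_l, gC_0, gS_0, Rplus_0_r.
  destruct (unit_proj G P) as [[? ?] ?], w as [[? ?] ?]; unfold comb3, scal3.
  triple_eq; ring.
Qed.

Lemma derive_of_geodesic G P sg ka w c v :
  (forall tau, c tau = geodesic_from G P sg ka w tau) -> is_derive c 0 v ->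
  v = initial_velocity G P sg ka w.
Proof.
  intros Hc Hv; apply (is_derive_R3_unique c 0); [exact Hv |].
  apply is_derive_ext with (geodesic_from G P sg ka w); [intros t; symmetry; apply Hc |].
  apply is_derive_geodesic_from.
Qed.

Lemma metric_initial_velocity G P sg1 ka1 w1 sg2 ka2 w2 :
  space G P -> unit_tangent G (unit_proj G P) w1 -> unit_tangent G (unit_proj G P) w2 ->
  metric G P (initial_velocity G P sg1 ka1 w1) (initial_velocity G P sg2 ka2 w2)
  = sg1 * sg2 + ka1 * ka2 * (curvature G * form G w1 w2).
Proof.
  intros HP [H1 _] [H2 _].
  rewrite <- (point_height_unit_proj G P HP) at 1.
  unfold initial_velocity; rewrite metric_point.
  - form_expand; ring.
  - now apply unit_proj_on_surface.
  - form_expand; rewrite H1; ring.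
  - form_expand; rewrite H2; ring.
Qed.

Lemma unit_tangent_cos G q w1 w2 :
  on_surface G q -> unit_tangent G q w1 -> unit_tangent G q w2 ->
  (curvature G * form G w1 w2) ^ 2 <= 1.
Proof.
  intros Hq [H1 N1] [H2 N2].
  pose proof (tangent_cauchy_schwarz G q w1 w2 Hq H1 H2) as H.
  rewrite N1, N2 in H. pose proof (curvature_sq G) as Hk.
  rewrite Rpow_mult_distr; replace (curvature G ^ 2) with 1 by lra; lra.
Qed.

Lemma angle_initial_velocity G P sg1 ka1 w1 sg2 ka2 w2 :
  space G P -> unit_tangent G (unit_proj G P) w1 -> unit_tangent G (unit_proj G P) w2 ->
  direction sg1 ka1 -> direction sg2 ka2 ->
  angle G P (initial_velocity G P sg1 ka1 w1) (initial_velocity G P sg2 ka2 w2)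
  = acos (sg1 * sg2 + ka1 * ka2 * (curvature G * form G w1 w2)).
Proof.
  intros HP H1 H2 [D1 _] [D2 _]; unfold angle.
  rewrite !metric_initial_velocity by assumption.
  rewrite (proj2 H1), (proj2 H2), curvature_sq.
  replace (sg1 * sg1 + ka1 * ka1 * 1) with 1 by lra.
  replace (sg2 * sg2 + ka2 * ka2 * 1) with 1 by lra.
  rewrite sqrt_1; f_equal; field.
Qed.

Lemma direction_cos_range sg1 ka1 sg2 ka2 m :
  direction sg1 ka1 -> direction sg2 ka2 -> m ^ 2 <= 1 ->
  -1 <= sg1 * sg2 + ka1 * ka2 * m <= 1.
Proof.
  intros [D1 K1] [D2 K2] Hm.
  assert (H : (sg1 * sg2 + ka1 * (ka2 * m)) ^ 2 <= 1 * 1).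
  { assert (Hcs : (sg1 * sg2 + ka1 * (ka2 * m)) ^ 2
        <= (sg1 ^ 2 + ka1 ^ 2) * (sg2 ^ 2 + (ka2 * m) ^ 2))
      by (generalize (pow2_ge_0 (sg1 * (ka2 * m) - ka1 * sg2)); lra).
    rewrite D1 in Hcs.
    assert ((ka2 * m) ^ 2 <= ka2 ^ 2).
    { rewrite Rpow_mult_distr.
      assert (ka2 ^ 2 * m ^ 2 <= ka2 ^ 2 * 1)
        by (apply Rmult_le_compat_l; [apply pow2_ge_0 | exact Hm]). lra. }
    lra. }
  nra.
Qed.

(** Both factors under the root are [L_i ^ 2]. *)
Lemma isoptic_quotient L1 L2 sg1 ka1 sg2 ka2 m :
  0 < L1 -> 0 < L2 -> direction sg1 ka1 -> direction sg2 ka2 ->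
  (L1 * ka1 * (L2 * ka2) * m + L1 * sg1 * (L2 * sg2))
    / sqrt (((L1 * sg1) ^ 2 + (L1 * ka1) ^ 2) * ((L2 * sg2) ^ 2 + (L2 * ka2) ^ 2))
  = sg1 * sg2 + ka1 * ka2 * m.
Proof.
  intros H1 H2 [D1 _] [D2 _].
  replace (((L1 * sg1) ^ 2 + (L1 * ka1) ^ 2) * ((L2 * sg2) ^ 2 + (L2 * ka2) ^ 2))
    with ((L1 * L2) * (L1 * L2)).
  - rewrite sqrt_square by (apply Rmult_le_pos; lra). field; lra.
  - transitivity ((L1 * L2) * (L1 * L2) * (sg1 ^ 2 + ka1 ^ 2) * (sg2 ^ 2 + ka2 ^ 2));
      [rewrite D1, D2; ring | ring].
Qed.

Lemma shortest_length_unique G P A c L c' L' :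
  shortest G P A c L -> shortest G P A c' L' -> L = L'.
Proof.
  intros [H1 H2] [H1' H2']; apply Rle_antisym; [exact (H2 _ _ H1') | exact (H2' _ _ H1)].
Qed.

Lemma ln_norm3_quotient G A P :
  space G A -> space G P -> ln (norm3 G A / norm3 G P) = height G A - height G P.
Proof. intros HA HP; apply ln_div; now apply norm3_pos. Qed.

Theorem theorem3p8 :
  forall (G : geometry) (a b c alpha : R),
    space G (a, b, c) -> 0 < alpha < PI ->
  forall x y z : R,
    space G (x, y, z) ->
    (x, y, z) <> (1, 0, 0) -> (x, y, z) <> (a, b, c) ->
    let a1 : R3 := (1, 0, 0) in
    let a2 : R3 := (a, b, c) in
    let p : R3 := (x, y, z) in
    isoptic G alpha a1 a2 p <->
    exists d1 d2 gamma : R,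
      is_distance G (unit_proj G p) (unit_proj G a1) d1 /\
      is_distance G (unit_proj G p) (unit_proj G a2) d2 /\
      internal_angle G (unit_proj G p) (unit_proj G a1) (unit_proj G a2) gamma /\
      cos alpha =
        (d1 * d2 * cos gamma
         + ln (norm3 G a1 / norm3 G p) * ln (norm3 G a2 / norm3 G p))
        / sqrt ((ln (norm3 G a1 / norm3 G p) ^ 2 + d1 ^ 2)
                * (ln (norm3 G a2 / norm3 G p) ^ 2 + d2 ^ 2)).
Proof.
  intros G a b c alpha HA2 Halpha x y z HP Hne1 Hne2 a1 a2 p.
  fold a2 in HA2, Hne2; fold a1 in Hne1; fold p in HP, Hne1, Hne2.
  assert (HA1 : space G a1) by apply (origin_on_surface G).
  clearbody a1 a2 p; clear a b c x y z.
  rewrite !ln_norm3_quotient by assumption.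
  pose proof (unit_proj_on_surface G p HP) as Hq.
  set (q := unit_proj G p) in *.
  pose proof (unit_proj_id G q Hq) as Hqq.
  split.
  - (* The horizontal curves with directions w1 and w2 serve as sides at the
       projected point, also when a side has length 0 and could point anywhere. *)
    intros [_ [_ [_ [c1 [c2 [L1 [L2 [v1 [v2 [S1 [S2 [V1 [V2 Ha]]]]]]]]]]]]].
    destruct (project_shortest G p a1 c1 L1 HP HA1 Hne1 S1)
      as [sg1 [ka1 [w1 [D1 [W1 [C1 [HL1 [E1 T1]]]]]]]].
    destruct (project_shortest G p a2 c2 L2 HP HA2 Hne2 S2)
      as [sg2 [ka2 [w2 [D2 [W2 [C2 [HL2 [E2 T2]]]]]]]].
    fold q in T1, T2, W1, W2.
    pose proof (unit_tangent_cos G q w1 w2 Hq W1 W2) as Hm.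
    set (m := curvature G * form G w1 w2) in *.
    assert (H01 : direction 0 1) by (split; lra).
    exists (L1 * ka1), (L2 * ka2), (acos m).
    split; [eexists; exact T1 |]; split; [eexists; exact T2 |].
    split.
    + exists (geodesic_from G q 0 1 w1), (geodesic_from G q 0 1 w2), (L1 * ka1), (L2 * ka2).
      eexists; eexists.
      split; [exact T1 |]; split; [exact T2 |].
      split; [apply is_derive_geodesic_from |]; split; [apply is_derive_geodesic_from |].
      rewrite angle_initial_velocity; rewrite ?Hqq; try assumption; [| apply Hq].
      fold m; f_equal; ring.
    + rewrite (derive_of_geodesic G p _ _ _ c1 v1 C1 V1),
        (derive_of_geodesic G p _ _ _ c2 v2 C2 V2) in Ha.
      rewrite angle_initial_velocity in Ha by assumption; fold m in Ha.
      rewrite Ha, cos_acos by (apply direction_cos_range; assumption).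
      rewrite cos_acos by nra.
      rewrite <- E1, <- E2; symmetry; now apply isoptic_quotient.
  - intros [d1 [d2 [gamma [[e1 R1] [[e2 R2] [Hg Hcos]]]]]].
    destruct Hg as [c1 [c2 [d1' [d2' [v1 [v2 [S1 [S2 [V1 [V2 Hg]]]]]]]]]].
    (* The distances and the sides of the angle may come from different curves. *)
    rewrite (shortest_length_unique _ _ _ _ _ _ _ S1 R1) in S1.
    rewrite (shortest_length_unique _ _ _ _ _ _ _ S2 R2) in S2.
    destruct (lift_shortest G p a1 c1 d1 HP HA1 Hne1 S1)
      as [sp1 [kp1 [w1 [P1 [W1 [C1 [Z1 [Y1 [L1 [sg1 [ka1 [HL1 [D1 [E1 [F1 T1]]]]]]]]]]]]]]].
    destruct (lift_shortest G p a2 c2 d2 HP HA2 Hne2 S2)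
      as [sp2 [kp2 [w2 [P2 [W2 [C2 [Z2 [Y2 [L2 [sg2 [ka2 [HL2 [D2 [E2 [F2 T2]]]]]]]]]]]]]]].
    fold q in C1, C2, W1, W2.
    pose proof (unit_tangent_cos G q w1 w2 Hq W1 W2) as Hm.
    split; [exact HP |]; split; [exact Hne1 |]; split; [exact Hne2 |].
    exists (geodesic_from G p sg1 ka1 w1), (geodesic_from G p sg2 ka2 w2), L1, L2.
    eexists; eexists.
    split; [exact T1 |]; split; [exact T2 |].
    split; [apply is_derive_geodesic_from |]; split; [apply is_derive_geodesic_from |].
    rewrite angle_initial_velocity by assumption.
    rewrite (derive_of_geodesic G q _ _ _ c1 v1 C1 V1),
      (derive_of_geodesic G q _ _ _ c2 v2 C2 V2) in Hg.
    rewrite angle_initial_velocity in Hg by (rewrite ?Hqq; try assumption; apply Hq).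
    set (m := curvature G * form G w1 w2) in *.
    (* A side of length 0 contributes an arbitrary slope to gamma; the factor d_i
       removes it. *)
    assert (Hdg : d1 * d2 * cos gamma = d1 * d2 * m).
    { rewrite Hg, cos_acos by (apply direction_cos_range; assumption).
      replace (d1 * d2 * (sp1 * sp2 + kp1 * kp2 * m))
        with ((d1 * sp1) * (d2 * sp2) + (d1 * kp1) * (d2 * kp2) * m) by ring.
      rewrite Z1, Z2, Y1, Y2; ring. }
    rewrite Hdg, <- E1, <- E2, <- F1, <- F2 in Hcos.
    rewrite isoptic_quotient in Hcos by assumption.
    rewrite <- Hcos, acos_cos; lra.
Qed.
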